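(* There is an algorithm that, given an $n$-vertex graph $G$ and an irredundant clique-width expression of $G$ of width $\mathrm{cw}$, computes, for every $\ell\in[0,n/2]$, the number of induced matchings of $G$ of size $\ell$, in time $3^{\mathrm{cw}} n^{O(1)}$ (polynomial factors in the input size suppressed).
   Context: All graphs are finite, simple and undirected. For a set of edges $M$, $V_M$ denotes the vertices incident with edges of $M$; a matching $M$ of $G$ is induced if $G[V_M]$ is $1$-regular. A clique-width expression of width $k$ builds a vertex-labeled graph with labels in $[k]$ using: $i(v)$ (create a single vertex $v$ with label $i$); $H_1\oplus H_2$ (disjoint union); $\eta_{i,j}(H)$ for $i\neq j$ (add all edges between vertices labeled $i$ and vertices labeled $j$); $\rho_{i\to j}(H)$ (relabel all vertices of label $i$ to label $j$). It describes $G$ if the final graph, with labels removed, is $G$. The expression is irredundant if whenever $\eta_{i,j}$ is applied to a graph, that graph contains no edge between a vertex of label $i$ and a vertex of label $j$. *)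

(* Defs.v *)
From Stdlib Require Import BinNums.
From mathcomp Require Import all_boot.

Set Implicit Arguments.
Unset Strict Implicit.
Unset Printing Implicit Defensive.

(** * Induced matchings
    A simple undirected graph on a finite type is a symmetric irreflexive
    relation [e]; its edges are the two-element sets of adjacent vertices. *)

Section InducedMatchings.
Variables (T : finType) (e : rel T).

Definition edges : {set {set T}} :=
  [set A | [exists x, exists y, e x y && (A == [set x; y])]].

Definition matching (M : {set {set T}}) : bool :=
  (M \subset edges) && trivIset M.

(** [cover M] is the set V_M of the vertices incident with edges of [M]. *)
Definition induced_matching (M : {set {set T}}) : bool :=
  matching M &&
  [forall x in cover M, #|[set y in cover M | e x y]| == 1].

Definition num_induced_matchings (l : nat) : nat :=
  #|[set M : {set {set T}} | induced_matching M && (#|M| == l)]|.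

End InducedMatchings.

(** * Clique-width expressions of width [k] *)

Inductive cwexpr (T : Type) (k : nat) : Type :=
| CWvertex (i : 'I_k) (v : T)
| CWunion (a b : cwexpr T k)
| CWjoin (i j : 'I_k) (a : cwexpr T k)
| CWrelabel (i j : 'I_k) (a : cwexpr T k).

Section CliqueWidthExpressions.
Variables (T : finType) (k : nat).
Implicit Type phi : cwexpr T k.

(** The labelling of the graph built by [phi]; [None] means that the vertex
    does not belong to that graph. *)
Fixpoint cw_label phi (v : T) : option 'I_k :=
  match phi with
  | CWvertex i u => if v == u then Some i else None
  | CWunion a b => if cw_label a v is Some i then Some i else cw_label b v
  | CWjoin _ _ a => cw_label a v
  | CWrelabel i j a =>
      if cw_label a v == Some i then Some j else cw_label a v
  end.

Definition cw_vertices phi : {set T} := [set v | cw_label phi v != None].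

Fixpoint cw_edge phi (x y : T) : bool :=
  match phi with
  | CWvertex _ _ => false
  | CWunion a b => cw_edge a x y || cw_edge b x y
  | CWjoin i j a =>
      [|| cw_edge a x y,
          (cw_label a x == Some i) && (cw_label a y == Some j)
        | (cw_label a x == Some j) && (cw_label a y == Some i)]
  | CWrelabel _ _ a => cw_edge a x y
  end.

(** The side conditions on the operations: unions are disjoint, and joins are
    between distinct labels. *)
Fixpoint cw_valid phi : bool :=
  match phi with
  | CWvertex _ _ => true
  | CWunion a b =>
      [&& [disjoint cw_vertices a & cw_vertices b], cw_valid a & cw_valid b]
  | CWjoin i j a => (i != j) && cw_valid a
  | CWrelabel _ _ a => cw_valid a
  end.

Fixpoint cw_irredundant phi : bool :=
  match phi with
  | CWvertex _ _ => true
  | CWunion a b => cw_irredundant a && cw_irredundant b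
  | CWjoin i j a =>
      ~~ [exists x, exists y, [&& cw_label a x == Some i,
                                  cw_label a y == Some j & cw_edge a x y]]
      && cw_irredundant a
  | CWrelabel _ _ a => cw_irredundant a
  end.

Definition cw_describes phi (e : rel T) : Prop :=
  cw_vertices phi = [set: T] /\ cw_edge phi =2 e.

End CliqueWidthExpressions.

(** * Model of computation
    A first-order call-by-value functional language with general recursion
    whose only data are binary trees (in the style of the cons-tree languages of
    N. D. Jones, "Computability and Complexity from a Programming
    Perspective").  Every evaluation rule costs one time unit and stands for a
    bounded number (depending only on the program) of elementary pointer
    operations: trees are immutable and shared, and there is no arithmetic,
    no array and no equality test on trees, so numbers have to be manipulated
    bit by bit. *)

Inductive tree : Type := Leaf | Node (l r : tree).

Fixpoint tree_size (x : tree) : nat :=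
  if x is Node l r then (tree_size l + tree_size r).+1 else 1.

(** Variables are de Bruijn indices.  [ECase a b c] is [b] if [a] is a leaf,
    and otherwise [c] with variables 0 and 1 bound to the left and right
    subtrees of [a]. *)
Inductive expr : Type :=
| EVar (i : nat)
| ELeaf
| ENode (a b : expr)
| ECase (a b c : expr)
| ELet (a b : expr)
| ECall (f : nat) (a : expr).

(** The list of the bodies of the (unary) functions of the program; each has
    its argument as variable 0.  Function 0 is the entry point. *)
Definition program : Type := seq expr.

(** [eval P env a v t]: [a] evaluates to [v] in time [t]. *)
Inductive eval (P : program) : seq tree -> expr -> tree -> nat -> Prop :=
| eval_var env i : eval P env (EVar i) (nth Leaf env i) 1
| eval_leaf env : eval P env ELeaf Leaf 1
| eval_node env a b u v s t :
    eval P env a u s -> eval P env b v t ->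
    eval P env (ENode a b) (Node u v) (s + t).+1
| eval_case_leaf env a b c v s t :
    eval P env a Leaf s -> eval P env b v t ->
    eval P env (ECase a b c) v (s + t).+1
| eval_case_node env a b c l r v s t :
    eval P env a (Node l r) s -> eval P [:: l, r & env] c v t ->
    eval P env (ECase a b c) v (s + t).+1
| eval_let env a b u v s t :
    eval P env a u s -> eval P (u :: env) b v t ->
    eval P env (ELet a b) v (s + t).+1
| eval_call env f a u v s t :
    eval P env a u s -> eval P [:: u] (nth ELeaf P f) v t ->
    eval P env (ECall f a) v (s + t).+1.

Definition computes_in (P : program) (x y : tree) (t : nat) : Prop :=
  eval P [:: x] (nth ELeaf P 0) y t.

Lemma eval_det (P : program) env a v t v' t' :
  eval P env a v t -> eval P env a v' t' -> v = v' /\ t = t'.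
Proof.
move=> H; elim: H v' t' => {env a v t}; intros;
  match goal with H : eval _ _ _ ?v' ?t' |- _ = ?v' /\ _ = ?t' =>
    inversion H; subst end; try by [];
  repeat match goal with
  | IH : forall v' t', eval P ?env ?a v' t' -> _ = v' /\ _ = t',
    H : eval P ?env ?a _ _ |- _ =>
      let E := fresh "E" in let F := fresh "F" in
      have [E F] := IH _ _ H; clear IH; try discriminate E;
      try (injection E; intros); subst
  end; by [].
Qed.

(** * Encoding of inputs and outputs *)

Definition enc_bool (b : bool) : tree := if b then Node Leaf Leaf else Leaf.

Definition enc_list (s : seq tree) : tree := foldr Node Leaf s.

(** Numbers are in binary: the list of bits, least significant bit first,
    without leading zeros. *)
Fixpoint enc_pos (p : positive) : tree :=
  match p with
  | xH => Node (enc_bool true) Leaf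
  | xO q => Node (enc_bool false) (enc_pos q)
  | xI q => Node (enc_bool true) (enc_pos q)
  end.

Definition enc_nat (n : nat) : tree :=
  if bin_of_nat n is Npos p then enc_pos p else Leaf.

(** The number of vertices and the adjacency matrix. *)
Definition enc_graph (n : nat) (e : rel 'I_n) : tree :=
  Node (enc_nat n)
    (enc_list [seq enc_list [seq enc_bool (e x y) | y <- enum 'I_n]
              | x <- enum 'I_n]).

Fixpoint enc_cwexpr (n k : nat) (phi : cwexpr 'I_n k) : tree :=
  match phi with
  | CWvertex i v => Node (enc_nat 0) (Node (enc_nat i) (enc_nat v))
  | CWunion a b => Node (enc_nat 1) (Node (enc_cwexpr a) (enc_cwexpr b))
  | CWjoin i j a =>
      Node (enc_nat 2) (Node (Node (enc_nat i) (enc_nat j)) (enc_cwexpr a))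
  | CWrelabel i j a =>
      Node (enc_nat 3) (Node (Node (enc_nat i) (enc_nat j)) (enc_cwexpr a))
  end.

Definition enc_input (n k : nat) (e : rel 'I_n) (phi : cwexpr 'I_n k) : tree :=
  Node (enc_graph e) (enc_cwexpr phi).

(** The numbers of induced matchings of sizes 0, 1, ..., floor(n/2). *)
Definition enc_output (n : nat) (e : rel 'I_n) : tree :=
  enc_list [seq enc_nat (num_induced_matchings e l) | l <- iota 0 n./2.+1].

(* Main.v *)
Require Import Defs.
From Stdlib Require Import BinNums String.
From mathcomp Require Import all_boot zify.

(** A set [S] of vertices spans an induced matching iff it induces a 1-regular
    graph.  Along a clique-width expression, a label class of such an [S] is
    empty (state 0), a single unmatched vertex (state 1) or consists of matched
    vertices (state 2): an unmatched vertex that shares its class can never be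
    matched legally.  This gives 3^k state vectors.

    Let F(s) be the generating function, with respect to the number of vertices
    and of joined pairs, of the partial solutions whose states are at most s
    componentwise, two classes being merged by taking the maximum of their
    states.  Then a disjoint union becomes a pointwise product, a relabelling a
    substitution of arguments, and a join an inclusion-exclusion formula in two
    coordinates.  Taking maxima also admits illegal merges, but each of them
    makes the number of vertices exceed twice the number of pairs plus the number
    of classes in state 1, an excess that never disappears.  So the number of
    induced matchings of size l is the coefficient of y^(2l) x^l in F(2, ..., 2).

    The polynomials are evaluated at y = 2^(n+1) and x = y^(n+1), where the
    coefficients can be read off as digits in base y. *)

Set Implicit Arguments.
Unset Strict Implicit.
Unset Printing Implicit Defensive.

(** * The program *)

(** [expr] with named variables instead of de Bruijn indices.  The leaf branch
    of [SPair] is never taken. *)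
Inductive sexpr : Type :=
| SVar (x : string)
| SLeaf
| SNode (a b : sexpr)
| SCase (a b : sexpr) (x y : string) (c : sexpr)
| SLet (x : string) (a b : sexpr)
| SCall (f : nat) (a : sexpr).

Definition SPair a x y c := SCase a SLeaf x y c.

Fixpoint position (x : string) (ctx : seq string) : nat :=
  if ctx is y :: ctx' then if String.eqb x y then 0 else (position x ctx').+1
  else 0.

Fixpoint compile (ctx : seq string) (a : sexpr) : expr :=
  match a with
  | SVar x => EVar (position x ctx)
  | SLeaf => ELeaf
  | SNode a b => ENode (compile ctx a) (compile ctx b)
  | SCase a b x y c =>
      ECase (compile ctx a) (compile ctx b) (compile [:: x, y & ctx] c)
  | SLet x a b => ELet (compile ctx a) (compile (x :: ctx) b)
  | SCall f a => ECall f (compile ctx a)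
  end.

Definition fn (x : string) (a : sexpr) : expr := compile [:: x] a.

Definition f_main := 0.
Definition f_inc := 1.
Definition f_dbl := 2.
Definition f_dec := 3.
Definition f_add := 4.
Definition f_sub := 5.
Definition f_mul := 6.
Definition f_zip := 7.
Definition f_const := 8.
Definition f_vertex := 9.
Definition f_set := 10.
Definition f_pick := 11.
Definition f_udouble := 12.
Definition f_unary := 13.
Definition f_umax := 14.
Definition f_depth := 15.
Definition f_table := 16.
Definition f_join := 17.
Definition f_last := 18.
Definition f_pow2 := 19.
Definition f_pow := 20.
Definition f_mod := 21.
Definition f_div := 22.
Definition f_digits := 23.
Definition f_output := 24.

Section Program.
Local Open Scope string_scope.
Local Coercion SVar : string >-> sexpr.
Local Notation "<< >>" := SLeaf.
Local Notation "<< a , .. , b , c >>" := (SNode a .. (SNode b c) ..).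
Local Notation bit1 := (SNode SLeaf SLeaf).

(** * Arithmetic on binary numbers *)

Definition b_inc := fn "r"
  (SCase "r" << bit1, << >> >>
   "b" "q" (SCase "b" << bit1, "q" >> "_" "_" << << >>, SCall f_inc "q" >>)).

(** Zero stays the empty list: no leading zero arises and encodings stay canonical. *)
Definition b_dbl := fn "r" (SCase "r" << >> "_" "_" << << >>, "r" >>).

Definition b_dec := fn "r"
  (SCase "r" << >>
   "b" "q" (SCase "b" << bit1, SCall f_dec "q" >> "_" "_" (SCall f_dbl "q"))).

Definition b_add := fn "ab"
  (SPair "ab" "a" "b"
  (SCase "a" "b" "a0" "a1"
  (SCase "b" "a" "b0" "b1"
  (SLet "r" (SCall f_add << "a1", "b1" >>)
  (SCase "a0" << "b0", "r" >> "_" "_"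
  (SCase "b0" << bit1, "r" >> "_" "_"
     << << >>, SCall f_inc "r" >>)))))).

(** The borrow case is [2a - (2b + 1) = 2(a - b - 1) + 1], hence the decrement of [r]. *)
Definition b_sub := fn "ab"
  (SPair "ab" "a" "b"
  (SCase "b" "a" "b0" "b1"
  (SCase "a" << >> "a0" "a1"
  (SLet "r" (SCall f_sub << "a1", "b1" >>)
  (SCase "a0"
    (SCase "b0" (SCall f_dbl "r") "_" "_" << bit1, SCall f_dec "r" >>)
    "_" "_"
    (SCase "b0" << bit1, "r" >> "_" "_" (SCall f_dbl "r"))))))).

Definition b_mul := fn "ab"
  (SPair "ab" "a" "b"
  (SCase "a" << >> "a0" "a1"
  (SLet "r" (SCall f_dbl (SCall f_mul << "a1", "b" >>))
  (SCase "a0" "r" "_" "_" (SCall f_add << "b", "r" >>))))).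

(** * Operations on tables indexed by state vectors *)

Definition b_zip := fn "x"
  (SPair "x" "op" "x" (SPair "x" "d" "tu" (SPair "tu" "t" "u"
  (SCase "d"
    (SCase "op" (SCall f_add "tu") "o" "_"
    (SCase "o" (SCall f_sub "tu") "_" "_" (SCall f_mul "tu")))
    "_" "d"
    (SPair "t" "t0" "t" (SPair "t" "t1" "t2"
    (SPair "u" "u0" "u" (SPair "u" "u1" "u2"
    << SCall f_zip << "op", "d", "t0", "u0" >>,
       SCall f_zip << "op", "d", "t1", "u1" >>,
       SCall f_zip << "op", "d", "t2", "u2" >> >>)))))))).

Definition b_const := fn "x"
  (SPair "x" "d" "v"
  (SCase "d" "v" "_" "d"
  (SLet "t" (SCall f_const << "d", "v" >>) << "t", "t", "t" >>))).

(** Equal branches share one subtree, so a table with [3 ^ d] entries is built in time linear in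
    [d]. *)
Definition b_vertex := fn "x"
  (SPair "x" "i" "x" (SPair "x" "d" "w" (SPair "d" "_" "d"
  (SCase "i"
    (SLet "c" (SCall f_const << "d", "w" >>)
     << SCall f_const << "d", bit1, << >> >>, "c", "c" >>)
    "_" "i"
    (SLet "t" (SCall f_vertex << "i", "d", "w" >>) << "t", "t", "t" >>))))).

Definition b_set := fn "x"
  (SPair "x" "i" "x" (SPair "x" "a" "t"
  (SPair "t" "t0" "t" (SPair "t" "t1" "t2"
  (SCase "i"
    (SLet "c" (SCase "a" "t0" "_" "a" (SCase "a" "t1" "_" "_" "t2"))
     << "c", "c", "c" >>)
    "_" "i"
    << SCall f_set << "i", "a", "t0" >>,
       SCall f_set << "i", "a", "t1" >>,
       SCall f_set << "i", "a", "t2" >> >>))))).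

(** The diagonal of three tables along coordinate [i]. Applied to a table with another coordinate
    frozen at 0, 1 and 2, it substitutes coordinate [i] for that other one, as a relabelling
    requires. *)
Definition b_pick := fn "x"
  (SPair "x" "i" "x" (SPair "x" "t" "x" (SPair "x" "u" "v"
  (SPair "t" "t0" "t" (SPair "t" "t1" "t2"
  (SPair "u" "u0" "u" (SPair "u" "u1" "u2"
  (SPair "v" "v0" "v" (SPair "v" "v1" "v2"
  (SCase "i" << "t0", "u1", "v2" >>
    "_" "i"
    << SCall f_pick << "i", "t0", "u0", "v0" >>,
       SCall f_pick << "i", "t1", "u1", "v1" >>,
       SCall f_pick << "i", "t2", "u2", "v2" >> >>)))))))))).

(** * Unary labels and the number of coordinates *)

Definition b_udouble := fn "u"
  (SCase "u" << >> "_" "u" << << >>, << >>, SCall f_udouble "u" >>).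

Definition b_unary := fn "r"
  (SCase "r" << >> "b" "r"
  (SLet "u" (SCall f_udouble (SCall f_unary "r"))
  (SCase "b" "u" "_" "_" << << >>, "u" >>))).

Definition b_umax := fn "uv"
  (SPair "uv" "u" "v"
  (SCase "u" "v" "_" "u'"
  (SCase "v" "u" "_" "v'" << << >>, SCall f_umax << "u'", "v'" >> >>))).

(** The width is not part of the encoded input. The tables get one coordinate more than the largest
    label that occurs, which is at most [k]. *)
Definition b_depth := fn "phi"
  (SPair "phi" "tag" "x"
  (SCase "tag"
    (SPair "x" "i" "_" << << >>, SCall f_unary "i" >>)
    "_" "tag"
  (SPair "x" "a" "b"
  (SCase "tag"
    (SCall f_umax << SCall f_depth "a", SCall f_depth "b" >>)
    "_" "_"
    (SPair "a" "i" "j"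
    (SCall f_umax << << << >>, SCall f_unary "i" >>,
      SCall f_umax << << << >>, SCall f_unary "j" >>, SCall f_depth "b" >> >>)))))).

(** * Evaluation of the generating function along the expression *)

Definition op_add := << >>.
Definition op_sub := << << >>, << >> >>.
Definition op_mul := << << << >>, << >> >>, << >> >>.

(** The tags are told apart by their bits: the empty list is a vertex; otherwise an empty tail is a
    union, and else the low bit separates joins from relabellings. In these three cases [q] is a
    subexpression, so its table is computed first. [w] stands for [y + 1]. *)
Definition b_table := fn "x"
  (SPair "x" "c" "phi" (SPair "c" "d" "wx" (SPair "phi" "tag" "x"
  (SCase "tag"
    (SPair "x" "i" "_" (SPair "wx" "w" "_"
      (SCall f_vertex << SCall f_unary "i", "d", "w" >>)))
    "b" "tag"
  (SPair "x" "p" "q"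
  (SLet "t" (SCall f_table << "c", "q" >>)
  (SCase "tag"
    (SCall f_zip << op_mul, "d", SCall f_table << "c", "p" >>, "t" >>)
    "_" "_"
  (SPair "p" "i" "j"
  (SLet "i" (SCall f_unary "i")
  (SLet "j" (SCall f_unary "j")
  (SCase "b"
    (SPair "wx" "_" "x" (SCall f_join << "d", "x", "i", "j", "t" >>))
    "_" "_"
    (SCall f_pick << "j",
       SCall f_set << "i", << >>, "t" >>,
       SCall f_set << "i", << << >>, << >> >>, "t" >>,
       SCall f_set << "i", << << >>, << >>, << >> >>, "t" >> >>)))))))))))).

(* [g] counts the solutions in which one of the two classes is empty, [h] those in
   which both are in state 1. *)
Definition b_join := fn "y"
  (SPair "y" "d" "y" (SPair "y" "x" "y" (SPair "y" "i" "y" (SPair "y" "j" "t"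
  (SLet "t0" (SCall f_set << "i", << >>, "t" >>)
  (SLet "t1" (SCall f_set << "i", << << >>, << >> >>, "t" >>)
  (SLet "t00" (SCall f_set << "j", << >>, "t0" >>)
  (SLet "t01" (SCall f_set << "j", << << >>, << >> >>, "t0" >>)
  (SLet "t10" (SCall f_set << "j", << >>, "t1" >>)
  (SLet "t11" (SCall f_set << "j", << << >>, << >> >>, "t1" >>)
  (SLet "g" (SCall f_zip << op_sub, "d",
      SCall f_zip << op_add, "d", "t0", SCall f_set << "j", << >>, "t" >> >>,
      "t00" >>)
  (SLet "h" (SCall f_zip << op_sub, "d",
      SCall f_zip << op_add, "d", "t11", "t00" >>,
      SCall f_zip << op_add, "d", "t01", "t10" >> >>)
  (SLet "h" (SCall f_zip << op_mul, "d", SCall f_const << "d", "x" >>, "h" >>)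
  (SLet "z" (SCall f_const << "d", << >> >>)
  (SCall f_zip << op_add, "d", "g",
     SCall f_pick << "j", "z", "z",
       SCall f_pick << "i", "z", "z", "h" >> >> >>))))))))))))))).

(** * Reading off the coefficients *)

Definition b_last := fn "x"
  (SPair "x" "d" "t"
  (SCase "d" "t" "_" "d"
  (SPair "t" "_" "t" (SPair "t" "_" "t" (SCall f_last << "d", "t" >>))))).

Definition b_pow2 := fn "u"
  (SCase "u" << bit1, << >> >> "_" "u" << << >>, SCall f_pow2 "u" >>).

Definition b_pow := fn "x"
  (SPair "x" "u" "b"
  (SCase "u" << bit1, << >> >> "_" "u"
  (SCall f_mul << "b", SCall f_pow << "u", "b" >> >>))).

Definition b_mod := fn "x"
  (SPair "x" "u" "r"
  (SCase "u" << >> "_" "u" (SCase "r" << >> "b" "r"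
  (SLet "q" (SCall f_mod << "u", "r" >>)
  (SCase "b" (SCall f_dbl "q") "_" "_" << bit1, "q" >>))))).

Definition b_div := fn "x"
  (SPair "x" "u" "r"
  (SCase "u" "r" "_" "u" (SCase "r" << >> "_" "r"
  (SCall f_div << "u", "r" >>)))).

(** Dropping two cells of [v] per round yields [n./2.+1] digits when [v] has length [n]. *)
Definition b_digits := fn "x"
  (SPair "x" "v" "x" (SPair "x" "u" "x" (SPair "x" "w" "r"
  << SCall f_mod << "u", "r" >>,
     SCase "v" << >> "_" "v" (SCase "v" << >> "_" "v"
     (SCall f_digits << "v", "u", "w", SCall f_div << "w", "r" >> >>)) >>))).

(* The tail of a power of 2 in binary serves as its logarithm in unary. *)
Definition b_output := fn "x"
  (SPair "x" "m" "x" (SPair "x" "y" "x" (SPair "x" "w" "r"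
  (SPair "y" "_" "u" (SPair "w" "_" "w"
  (SCall f_digits << "m", "u", "w", "r" >>)))))).

(** The list of rows of the adjacency matrix serves as [n] in unary. One more matching edge
    multiplies the weight by [y * (y * x)], which is therefore the step between the digits that are
    read. *)
Definition b_main := fn "x"
  (SPair "x" "g" "phi" (SPair "g" "_" "m"
  (SLet "y" (SCall f_dbl (SCall f_pow2 "m"))
  (SLet "x" (SCall f_mul << "y", SCall f_pow << "m", "y" >> >>)
  (SLet "d" (SCall f_depth "phi")
  (SLet "t" (SCall f_table << << "d", SCall f_inc "y", "x" >>, "phi" >>)
  (SCall f_output << "m", "y",
     SCall f_mul << "y", SCall f_mul << "y", "x" >> >>,
     SCall f_last << "d", "t" >> >>))))))).

End Program.

Definition prog : program := Eval compute in
  [:: b_main; b_inc; b_dbl; b_dec; b_add; b_sub; b_mul; b_zip; b_const;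
      b_vertex; b_set; b_pick; b_udouble; b_unary; b_umax; b_depth; b_table;
      b_join; b_last; b_pow2; b_pow; b_mod; b_div; b_digits;
      b_output].

(** * Evaluation within a time bound *)

Definition ev (env : seq tree) (a : expr) (v : tree) (b : nat) : Prop :=
  exists2 t, eval prog env a v t & t <= b.

Definition run (f : nat) (u v : tree) (b : nat) : Prop :=
  ev [:: u] (nth ELeaf prog f) v b.

Arguments run : simpl never.

Lemma ev_conv env a v b v' b' : ev env a v b -> v = v' -> b <= b' -> ev env a v' b'.
Proof. by move=> [t et le_tb] <- le_bb'; exists t => //; apply: leq_trans le_bb'. Qed.

Lemma run_conv f u v b v' b' : run f u v b -> v = v' -> b <= b' -> run f u v' b'.
Proof. exact: ev_conv. Qed.

Lemma ev_var env i : ev env (EVar i) (nth Leaf env i) 1.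
Proof. by exists 1; first exact: eval_var. Qed.

Lemma ev_leaf env : ev env ELeaf Leaf 1.
Proof. by exists 1; first exact: eval_leaf. Qed.

Lemma ev_node env a b u v s t :
  ev env a u s -> ev env b v t -> ev env (ENode a b) (Node u v) (s + t).+1.
Proof.
move=> [s' es le_s] [t' et le_t]; exists (s' + t').+1; first exact: eval_node.
by rewrite ltnS leq_add.
Qed.

(** One rule for both branches: once the value of [a] is known the conditional reduces, so symbolic
    execution never has to choose a rule. *)
Lemma ev_case env a b c u v s t : ev env a u s ->
  (if u is Node l r then ev [:: l, r & env] c v t else ev env b v t) ->
  ev env (ECase a b c) v (s + t).+1.
Proof.
move=> [s' es le_s]; case: u es => [|l r] es [t' et le_t].
  exists (s' + t').+1; last by rewrite ltnS leq_add.
  exact: eval_case_leaf.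
exists (s' + t').+1; last by rewrite ltnS leq_add.
exact: eval_case_node et.
Qed.

Lemma ev_let env a b u v s t :
  ev env a u s -> ev (u :: env) b v t -> ev env (ELet a b) v (s + t).+1.
Proof.
move=> [s' es le_s] [t' et le_t]; exists (s' + t').+1; last by rewrite ltnS leq_add.
exact: eval_let et.
Qed.

Lemma ev_call env f a u v s t :
  ev env a u s -> run f u v t -> ev env (ECall f a) v (s + t).+1.
Proof.
move=> [s' es le_s] [t' et le_t]; exists (s' + t').+1; last by rewrite ltnS leq_add.
exact: eval_call et.
Qed.

Lemma enc_nat0 : enc_nat 0 = Leaf.
Proof. by []. Qed.

Definition unary (n : nat) : tree := iter n (Node Leaf) Leaf.

Lemma unary0 : unary 0 = Leaf.
Proof. by []. Qed.

Lemma unaryS n : unary n.+1 = Node Leaf (unary n).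
Proof. by []. Qed.

Ltac ev_steps tac :=
  lazymatch goal with
  | |- ev _ (EVar _) _ _ => apply: ev_var
  | |- ev _ ELeaf _ _ => apply: ev_leaf
  | |- ev _ (ENode _ _) _ _ => eapply ev_node; [ev_steps tac | ev_steps tac]
  | |- ev _ (ECase _ _ _) _ _ =>
      eapply ev_case; [ev_steps tac | cbn [nth]; cbv iota beta; ev_steps tac]
  | |- ev _ (ELet _ _) _ _ => eapply ev_let; [ev_steps tac | ev_steps tac]
  | |- ev _ (ECall _ _) _ _ =>
      eapply ev_call; [ev_steps tac | cbn [nth]; tac]
  | |- _ => idtac
  end.

(** Executes the body of [f] symbolically, with [tac] resolving the calls. What remains are the side
    conditions of the calls, the equality of the results and the time bound. *)
Ltac run_steps tac :=
  lazymatch goal with |- run ?f _ _ _ =>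
    rewrite ?enc_nat0 ?unaryS ?unary0 /run; let p := eval compute in (nth ELeaf prog f) in
    change (nth ELeaf prog f) with p;
    eapply ev_conv; [ev_steps tac | cbn [nth] | ]
  end.

(** * Binary arithmetic *)

Lemma enc_nat_bin b :
  enc_nat (nat_of_bin b) = if b is Npos p then enc_pos p else Leaf.
Proof. by rewrite /enc_nat nat_of_binK. Qed.

Lemma enc_natD n : 0 < n -> enc_nat n.*2 = Node Leaf (enc_nat n).
Proof.
rewrite -(bin_of_natK n); case: (bin_of_nat n) => [//|p] _.
have -> : (nat_of_bin (Npos p)).*2 = nat_of_bin (Npos (xO p)).
  by rewrite /= NatTrec.doubleE.
by rewrite !enc_nat_bin.
Qed.

Lemma enc_natS n : enc_nat n.*2.+1 = Node (Node Leaf Leaf) (enc_nat n).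
Proof.
rewrite -(bin_of_natK n); case: (bin_of_nat n) => [//|p].
have -> : (nat_of_bin (Npos p)).*2.+1 = nat_of_bin (Npos (xI p)).
  by rewrite /= NatTrec.doubleE.
by rewrite !enc_nat_bin.
Qed.

Lemma binary_ind (Q : nat -> Prop) :
  Q 0 -> (forall n, 0 < n -> Q n -> Q n.*2) -> (forall n, Q n -> Q n.*2.+1) ->
  forall n, Q n.
Proof.
move=> Q0 QD QS n; have [m] := ubnP n; elim: m n => // m IHm n le_nm.
have := odd_double_half n; case: (odd n) => /= def_n.
  by rewrite -def_n add1n; apply: QS; apply: IHm; lia.
rewrite -def_n add0n; case: (posnP n./2) => [-> //|n_gt0].
by apply: QD => //; apply: IHm; lia.
Qed.

Variant binary_spec : nat -> tree -> Prop :=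
| BinaryZero : binary_spec 0 Leaf
| BinaryEven n of 0 < n : binary_spec n.*2 (Node Leaf (enc_nat n))
| BinaryOdd n : binary_spec n.*2.+1 (Node (Node Leaf Leaf) (enc_nat n)).

Lemma binaryP n : binary_spec n (enc_nat n).
Proof.
elim/binary_ind: n => [|n n_gt0 _|n _].
- exact: BinaryZero.
- by rewrite enc_natD //; exact: BinaryEven.
- by rewrite enc_natS; exact: BinaryOdd.
Qed.

Lemma run_inc L n : n < 2 ^ L -> run f_inc (enc_nat n) (enc_nat n.+1) (10 * L.+1).
Proof.
elim/binary_ind: n L => [|n n_gt0 _|n IHn] L lt_nL.
- run_steps idtac; first by []. lia.
- rewrite enc_natD // enc_natS; run_steps idtac; first by []. lia.
- case: L lt_nL => [|L]; first by lia. 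
  rewrite expnS enc_natS -doubleS enc_natD // => lt_nL.
  run_steps ltac:(apply: (IHn L)); [lia|by []|lia].
Qed.

Lemma run_dbl n : run f_dbl (enc_nat n) (enc_nat n.*2) 6.
Proof.
case: (posnP n) => [->|n_gt0]; first by run_steps idtac.
rewrite enc_natD //; by case: binaryP n_gt0 => [|m _ _|m _] //; run_steps idtac.
Qed.

Lemma run_dec L n : 0 < n -> n < 2 ^ L ->
  run f_dec (enc_nat n) (enc_nat n.-1) (15 * L.+1).
Proof.
elim/binary_ind: n L => [//|n n_gt0 IHn|n IHn] L _ lt_nL.
- case: L lt_nL => [|L]; first by lia.
  rewrite expnS enc_natD // => lt_nL.
  run_steps ltac:(apply: (IHn L)); [lia|lia| |lia].
  by rewrite -enc_natS; congr enc_nat; lia.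
- rewrite enc_natS.
  run_steps ltac:(apply: run_dbl); [by []|lia].
Qed.

(** Quadratic, because a carry increments the recursive sum, at linear cost on each of the [L]
    levels. *)
Lemma run_add L a b : a < 2 ^ L -> b < 2 ^ L ->
  run f_add (Node (enc_nat a) (enc_nat b)) (enc_nat (a + b)) (50 * L.+1 ^ 2).
Proof.
elim: L a b => [|L IHL] a b lt_a lt_b.
  have -> : a = 0 by lia. have -> : b = 0 by lia.
  by run_steps idtac.
case: (binaryP a) lt_a => [|a' a_gt0|a'] lt_a.
- run_steps idtac; [by []|lia].
- case: (binaryP b) lt_b => [|b' b_gt0|b'] lt_b.
  + by run_steps idtac; [rewrite addn0 enc_natD|lia].
  + rewrite !expnS in lt_a, lt_b.
    run_steps ltac:(apply: IHL); [lia|lia| |lia].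
    by rewrite -doubleD enc_natD // addn_gt0 a_gt0.
  + rewrite !expnS in lt_a, lt_b.
    run_steps ltac:(apply: IHL); [lia|lia| |lia].
    by rewrite addnS -doubleD enc_natS.
- case: (binaryP b) lt_b => [|b' b_gt0|b'] lt_b.
  + by run_steps idtac; [rewrite addn0 enc_natS|lia].
  + rewrite !expnS in lt_a, lt_b.
    run_steps ltac:(apply: IHL); [lia|lia| |lia].
    by rewrite addSn -doubleD enc_natS.
  + rewrite !expnS in lt_a, lt_b.
    run_steps ltac:(first [apply: IHL | apply: (@run_inc L.+1)]);
      [lia|lia|rewrite expnS; lia| |lia].
    by rewrite addSn addnS -doubleD -doubleS enc_natD.
Qed.

Lemma run_sub L a b : b <= a -> a < 2 ^ L ->
  run f_sub (Node (enc_nat a) (enc_nat b)) (enc_nat (a - b)) (50 * L.+1 ^ 2).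
Proof.
elim: L a b => [|L IHL] a b le_ba lt_a.
  have -> : a = 0 by lia. have -> : b = 0 by lia.
  by run_steps idtac.
case: (binaryP b) le_ba => [|b' b_gt0|b'] le_ba.
- rewrite subn0; case: (enc_nat a) => [|l r]; run_steps idtac; [by []|lia|by []|lia].
- case: (binaryP a) lt_a le_ba => [|a' a_gt0|a'] lt_a le_ba; first by lia.
  + rewrite !expnS in lt_a.
    run_steps ltac:(first [apply: IHL | apply: run_dbl]); [lia|lia| |lia].
    by congr enc_nat; lia.
  + rewrite !expnS in lt_a.
    run_steps ltac:(first [apply: IHL | apply: run_dbl]); [lia|lia| |lia].
    by rewrite -enc_natS; congr enc_nat; lia.
- case: (binaryP a) lt_a le_ba => [|a' a_gt0|a'] lt_a le_ba; first by lia.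
  + rewrite !expnS in lt_a.
    run_steps ltac:(first [apply: IHL | apply: (@run_dec L)]);
      [lia|lia|lia|lia| |lia].
    by rewrite -enc_natS; congr enc_nat; lia.
  + rewrite !expnS in lt_a.
    run_steps ltac:(first [apply: IHL | apply: run_dbl]); [lia|lia| |lia].
    by congr enc_nat; lia.
Qed.

(** The recursion runs over the at most [M] bits of [a]. All intermediate values are bounded by the
    product, so each round costs at most one addition of [L]-bit numbers. *)
Lemma run_mul L M a b : a < 2 ^ M -> b < 2 ^ L -> a * b < 2 ^ L ->
  run f_mul (Node (enc_nat a) (enc_nat b)) (enc_nat (a * b))
    (80 * M.+1 * L.+1 ^ 2).
Proof.
move=> + lt_b; elim: M a => [|M IHM] a lt_a lt_ab.
  have -> : a = 0 by lia.
  by run_steps idtac; [|lia].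
rewrite expnS in lt_a.
case: (binaryP a) lt_a lt_ab => [|a' a_gt0|a'] lt_a lt_ab.
- by run_steps idtac; [|lia].
- run_steps ltac:(first [apply: IHM | apply: run_dbl]); [lia|lia| |lia].
  by rewrite doubleMl.
- run_steps ltac:(first [apply: IHM | apply: run_dbl | apply: (@run_add L)]);
    [lia|lia|lia|lia| |lia].
  by rewrite doubleMl mulSn.
Qed.

(** * Unary numbers *)

Fixpoint spine (u : tree) : nat := if u is Node _ r then (spine r).+1 else 0.

Lemma run_udouble n : run f_udouble (unary n) (unary n.*2) (10 * n.+1).
Proof.
elim: n => [|n IHn]; first by run_steps idtac.
by rewrite unaryS; run_steps ltac:(apply: IHn); [|lia].
Qed.

(** The doublings cost a geometric series, so the conversion is linear in the value. For labels this
    is affordable since [k < 3 ^ k]. *)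
Lemma run_unary n : run f_unary (enc_nat n) (unary n) (40 * n + 10).
Proof.
elim/binary_ind: n => [|n n_gt0 IHn|n IHn]; first by run_steps idtac.
- rewrite enc_natD //.
  by run_steps ltac:(first [apply: IHn | apply: run_udouble]); [|lia].
- rewrite enc_natS.
  by run_steps ltac:(first [apply: IHn | apply: run_udouble]); [|lia].
Qed.

Lemma run_umax m n :
  run f_umax (Node (unary m) (unary n)) (unary (maxn m n)) (20 * (m + n).+1).
Proof.
elim: m n => [|m IHm] [|n].
- by run_steps idtac.
- by rewrite unaryS; run_steps idtac; [|lia].
- by rewrite unaryS; run_steps idtac; [|lia].
- by rewrite !unaryS; run_steps ltac:(apply: IHm); [rewrite maxnSS|lia].
Qed.

Lemma run_pow2 u : run f_pow2 u (enc_nat (2 ^ spine u)) (10 * (spine u).+1).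
Proof.
elim: u => [|l _ r IHr]; first by run_steps idtac.
run_steps ltac:(apply: IHr); last by simpl; lia.
by rewrite /= expnS mul2n enc_natD // expn_gt0.
Qed.

Lemma spine_enc_nat_pow2 m : spine (enc_nat (2 ^ m)) = m.+1.
Proof. by elim: m => [//|m IHm]; rewrite expnS mul2n enc_natD ?expn_gt0 //= IHm. Qed.

Lemma run_pow L u b : 0 < b -> b ^ (spine u).+1 < 2 ^ L ->
  run f_pow (Node u (enc_nat b)) (enc_nat (b ^ spine u))
    (100 * (spine u).+1 * L.+1 ^ 3).
Proof.
move=> b_gt0; elim: u => [|l _ r IHr] /= lt_L; first by run_steps idtac; [|lia].
have lt_bL : b < 2 ^ L.
  by apply: leq_ltn_trans lt_L; rewrite expnS leq_pmulr // expn_gt0 b_gt0.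
have lt_rL : b ^ (spine r).+1 < 2 ^ L.
  by apply: leq_ltn_trans lt_L; rewrite [leqRHS]expnS leq_pmull.
have lt_rL' : b ^ (spine r) < 2 ^ L.
  by apply: leq_ltn_trans lt_rL; rewrite [leqRHS]expnS leq_pmull.
run_steps ltac:(first [apply: IHr | apply: (@run_mul L L)]) => //.
  by rewrite -expnS.
  by rewrite expnS.
rewrite -!mulnA -expnS; have : 0 < L.+1 ^ 3 by rewrite expn_gt0.
by move: (L.+1 ^ 3) => c; nia.
Qed.

Lemma run_mod u n :
  run f_mod (Node u (enc_nat n)) (enc_nat (n %% 2 ^ spine u)) (25 * (spine u).+1).
Proof.
elim: u n => [|l _ r IHr] n /=; first by run_steps idtac; rewrite ?modn1.
case: (binaryP n) => [|m m_gt0|m].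
- by run_steps idtac; [rewrite mod0n|lia].
- run_steps ltac:(first [apply: IHr | apply: run_dbl]); last by lia.
  by rewrite expnS -!mul2n muln_modr.
- run_steps ltac:(first [apply: IHr | apply: run_dbl]); last by lia.
  rewrite -enc_natS; congr enc_nat.
  have : 0 < 2 ^ spine r by rewrite expn_gt0.
  rewrite expnS; move: (2 ^ spine r) => p p_gt0.
  (* The remainder of [2m + 1] modulo [2p] is [2 (m %% p) + 1], which is below [2p]. *)
  have def_m : m.*2.+1 = m %/ p * (2 * p) + (m %% p).*2.+1.
    by rewrite mulnCA [in LHS](divn_eq m p) doubleD -mul2n addnS.
  rewrite def_m modnMDl; apply/esym/modn_small; have := ltn_pmod m p_gt0; lia.
Qed.

Lemma run_div u n :
  run f_div (Node u (enc_nat n)) (enc_nat (n %/ 2 ^ spine u)) (12 * (spine u).+1).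
Proof.
elim: u n => [|l _ r IHr] n /=; first by run_steps idtac; rewrite ?divn1.
case: (binaryP n) => [|m m_gt0|m].
- by run_steps idtac; [rewrite div0n|lia].
- run_steps ltac:(apply: IHr); last by lia.
  by rewrite expnS divnMA -mul2n mulKn.
- run_steps ltac:(apply: IHr); last by lia.
  rewrite expnS divnMA; congr (enc_nat (_ %/ _)); lia.
Qed.

Lemma run_digits m u w n :
  run f_digits (Node m (Node u (Node w (enc_nat n))))
    (enc_list [seq enc_nat (n %/ 2 ^ (l * spine w) %% 2 ^ spine u)
              | l <- iota 0 (spine m)./2.+1])
    ((spine m).+1 * (25 * (spine u).+1 + 12 * (spine w).+1 + 40)).
Proof.
have [k] := ubnP (spine m); elim: k m n => // k IHk [|l [|l' r]] n /= lt_mk.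
- run_steps ltac:(apply: run_mod); last by lia.
  by rewrite mul0n divn1.
- run_steps ltac:(apply: run_mod); last by lia.
  by rewrite mul0n divn1.
- run_steps ltac:(first [apply: run_mod | apply: run_div | apply: IHk]); [lia| |nia].
  rewrite -[Node _ (enc_list _) in RHS]/(enc_list (map _ (iota (1 + 0) _.+1))).
  rewrite iotaDl -map_comp mul0n divn1; congr (Node _ (enc_list _)).
  by apply: eq_map => i /=; rewrite -divnMA -expnD mulnDl mul1n.
Qed.

(** * Tables *)

Definition states (d : nat) (s : seq nat) : bool :=
  (size s == d) && all (fun a => a <= 2) s.

Lemma states_cons d a s : a <= 2 -> states d s -> states d.+1 (a :: s).
Proof. by move=> le_a2 /andP [/eqP <- s_le2]; rewrite /states /= eqxx le_a2. Qed.

Fixpoint table (d : nat) (F : seq nat -> nat) : tree :=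
  if d is d'.+1 then
    Node (table d' (fun s => F (0 :: s)))
      (Node (table d' (fun s => F (1 :: s))) (table d' (fun s => F (2 :: s))))
  else enc_nat (F [::]).

Lemma eq_table d F G : (forall s, states d s -> F s = G s) -> table d F = table d G.
Proof.
elim: d F G => [|d IHd] F G eqFG /=; first by rewrite eqFG.
by congr (Node _ (Node _ _)); apply: IHd => s ss; apply: eqFG; apply: states_cons.
Qed.

Variant binop := OpAdd | OpSub | OpMul.

Definition binop_code (o : binop) : tree :=
  match o with
  | OpAdd => Leaf
  | OpSub => Node Leaf Leaf
  | OpMul => Node (Node Leaf Leaf) Leaf
  end.

Definition binop_fun (o : binop) (a b : nat) : nat :=
  match o with OpAdd => a + b | OpSub => a - b | OpMul => a * b end.

Definition binop_dom (L : nat) (o : binop) (a b : nat) : bool :=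
  [&& a < 2 ^ L, b < 2 ^ L, binop_fun o a b < 2 ^ L & if o is OpSub then b <= a else true].

Lemma run_zip L o d F G :
  (forall s, states d s -> binop_dom L o (F s) (G s)) ->
  run f_zip (Node (binop_code o) (Node (unary d) (Node (table d F) (table d G))))
    (table d (fun s => binop_fun o (F s) (G s)))
    (3 ^ d * (200 * L.+1 ^ 3)).
Proof.
have [c def_c] : {c | c = L.+1 ^ 3} by exists (L.+1 ^ 3).
have c_gt0 : 0 < c by rewrite def_c expn_gt0.
rewrite -def_c => dom.
(* The subtracted 70 pays for the inner nodes: three recursive calls leave a slack of 140 for the
   constant cost of a node. *)
suff /run_conv : run f_zip
    (Node (binop_code o) (Node (unary d) (Node (table d F) (table d G))))
    (table d (fun s => binop_fun o (F s) (G s))) (3 ^ d * (100 * c + 70) - 70).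
  by apply=> //; apply: leq_trans (leq_subr _ _) _; rewrite leq_mul2l; lia.
elim: d F G dom => [|d IHd] F G dom.
  have {dom} /and4P [ltF ltG ltFG leGF] := dom [::] isT.
  rewrite /table; case: o ltFG leGF => /= ltFG leGF.
  - run_steps ltac:(apply: (@run_add L)) => //; lia.
  - run_steps ltac:(apply: (@run_sub L)) => //; lia.
  - run_steps ltac:(apply: (@run_mul L L)) => //; lia.
have pos : 0 < 3 ^ d by rewrite expn_gt0.
rewrite unaryS /=; run_steps ltac:(apply: IHd) => //.
- by move=> s ss; apply: dom; apply: states_cons.
- by move=> s ss; apply: dom; apply: states_cons.
- by move=> s ss; apply: dom; apply: states_cons.
- rewrite expnS; nia.
Qed.

Lemma run_const d n :
  run f_const (Node (unary d) (enc_nat n)) (table d (fun => n)) (20 * d.+1).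
Proof.
elim: d => [|d IHd]; first by run_steps idtac.
by rewrite unaryS; run_steps ltac:(apply: IHd); [|lia].
Qed.

Lemma run_vertex i d w : i < d ->
  run f_vertex (Node (unary i) (Node (unary d) (enc_nat w)))
    (table d (fun s => if 0 < nth 0 s i then w else 1)) (70 * d.+1).
Proof.
elim: d i => // d IHd [|i] lt_id; rewrite !unaryS.
  run_steps ltac:(first [apply: run_const | apply: (@run_const d 1)]) => //; lia.
by run_steps ltac:(apply: IHd) => //; lia.
Qed.

Lemma run_set i a d F : i < d -> a <= 2 ->
  run f_set (Node (unary i) (Node (unary a) (table d F)))
    (table d (fun s => F (set_nth 0 s i a))) (3 ^ d * 80).
Proof.
move=> + le_a2.
suff H : i < d -> run f_set (Node (unary i) (Node (unary a) (table d F)))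
    (table d (fun s => F (set_nth 0 s i a))) (3 ^ d * 80 - 40).
  by move=> lt_id; apply: run_conv (H lt_id) _ _ => //; lia.
elim: d i F => // d IHd [|i] F lt_id /=; have pos : 0 < 3 ^ d by rewrite expn_gt0.
  case: a le_a2 {IHd} => [|[|[|//]]] _; run_steps idtac => //; rewrite expnS; lia.
run_steps ltac:(apply: IHd) => //; rewrite expnS; lia.
Qed.

Lemma run_pick i d F G H : i < d ->
  run f_pick (Node (unary i) (Node (table d F) (Node (table d G) (table d H))))
    (table d (fun s => nth F [:: F; G; H] (nth 0 s i) s)) (3 ^ d * 160).
Proof.
suff K : i < d ->
  run f_pick (Node (unary i) (Node (table d F) (Node (table d G) (table d H))))
    (table d (fun s => nth F [:: F; G; H] (nth 0 s i) s)) (3 ^ d * 160 - 80).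
  by move=> lt_id; apply: run_conv (K lt_id) _ _ => //; lia.
elim: d i F G H => // d IHd [|i] F G H lt_id /=; have pos : 0 < 3 ^ d by rewrite expn_gt0.
  by run_steps idtac => //; rewrite expnS; lia.
run_steps ltac:(apply: IHd) => //; last by rewrite expnS; lia.
by congr (Node _ (Node _ _)); apply: eq_table => s _;
  case: (nth 0 s i) => [|[|[|j]]] //=; rewrite !nth_nil.
Qed.

Lemma run_last d F :
  run f_last (Node (unary d) (table d F)) (enc_nat (F (nseq d 2))) (20 * d.+1).
Proof.
elim: d F => [|d IHd] F /=; first by run_steps idtac.
by run_steps ltac:(apply: IHd) => //; lia.
Qed.

(** * Partial solutions *)

Section PartialSolutions.
Variables (T : finType) (k : nat).
Implicit Types (phi a b : cwexpr T k) (S A : {set T}) (l : 'I_k).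

(** [state phi S l] is 0 if [S] has no vertex of label [l], 1 if it is expected to
    have exactly one, still unmatched, and 2 if all of them are expected to be
    matched.  Merging two nonempty classes of which one is in state 1 is not
    forbidden; such sets are discarded by counting, see [admissible_ones]. *)
Fixpoint state phi S : 'I_k -> nat :=
  match phi with
  | CWvertex i v => fun l => (v \in S) && (l == i)
  | CWunion a b => fun l => maxn (state a S l) (state b S l)
  | CWjoin i j a => fun l =>
      if [&& state a S i == 1, state a S j == 1 & (l == i) || (l == j)] then 2
      else state a S l
  | CWrelabel i j a => fun l =>
      if l == j then maxn (state a S i) (state a S j)
      else if l == i then 0 else state a S l
  end.

(** In an irredundant expression, a join of two nonempty classes keeps all degrees at most 1 only if
    each class is a single unmatched vertex. *)
Fixpoint admissible phi S : bool :=
  match phi with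
  | CWvertex _ _ => true
  | CWunion a b => admissible a S && admissible b S
  | CWjoin i j a => admissible a S &&
      [|| state a S i == 0, state a S j == 0
        | (state a S i == 1) && (state a S j == 1)]
  | CWrelabel _ _ a => admissible a S
  end.

Fixpoint pairs phi S : nat :=
  match phi with
  | CWvertex _ _ => 0
  | CWunion a b => pairs a S + pairs b S
  | CWjoin i j a => pairs a S + ((state a S i == 1) && (state a S j == 1))
  | CWrelabel _ _ a => pairs a S
  end.

Definition ones phi S : nat := \sum_l (state phi S l == 1).

Definition degree phi S (v : T) : nat := #|[set u in S | cw_edge phi v u]|.

Definition class phi S l : {set T} := [set v in S | cw_label phi v == Some l].

Lemma state_le2 phi S l : state phi S l <= 2.
Proof.
elim: phi l => [i v|a IHa b IHb|i j a IHa|i j a IHa] l /=.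
- by case: (_ && _).
- by rewrite geq_max IHa IHb.
- by case: ifP.
- by case: ifP => _; [rewrite geq_max !IHa | case: ifP].
Qed.

(** * Dependence on the vertices of the expression only *)

Lemma cw_vertices_union a b :
  cw_vertices (CWunion a b) = cw_vertices a :|: cw_vertices b :> {set T}.
Proof. by apply/setP=> v; rewrite !inE /=; case: (cw_label a v). Qed.

Lemma cw_vertices_relabel i j (a : cwexpr T k) :
  cw_vertices (CWrelabel i j a) = cw_vertices a.
Proof. by apply/setP=> v; rewrite !inE /=; case: ifP => [/eqP ->|]. Qed.

Lemma cw_edge_vertices phi x y :
  cw_edge phi x y -> (x \in cw_vertices phi) && (y \in cw_vertices phi).
Proof.
elim: phi => [//|a IHa b IHb|i j a IHa|i j a IHa].
- rewrite cw_vertices_union !inE /= => /orP [/IHa|/IHb] /andP [];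
    rewrite !inE => -> ->; by rewrite ?orbT.
- rewrite !inE /= => /or3P [/IHa|/andP [/eqP -> /eqP ->]|/andP [/eqP -> /eqP ->]] //.
  by rewrite !inE.
- by rewrite cw_vertices_relabel => /IHa.
Qed.

Lemma state_setI phi S A : cw_vertices phi \subset A ->
  state phi (S :&: A) =1 state phi S.
Proof.
elim: phi => [i v|a IHa b IHb|i j a IHa|i j a IHa] /= subA l.
- rewrite inE; case: (boolP (v \in A)); first by rewrite andbT.
  by case/negP; apply: (subsetP subA); rewrite inE /= eqxx.
- move: subA; rewrite cw_vertices_union subUset => /andP [subA subB].
  by rewrite IHa ?IHb.
- by rewrite !IHa.
- by rewrite cw_vertices_relabel in subA; rewrite !IHa.
Qed.

Lemma admissible_setI phi S A : cw_vertices phi \subset A ->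
  admissible phi (S :&: A) = admissible phi S.
Proof.
elim: phi => [i v|a IHa b IHb|i j a IHa|i j a IHa] /= subA //.
- move: subA; rewrite cw_vertices_union subUset => /andP [subA subB].
  by rewrite IHa ?IHb.
- by rewrite !state_setI ?IHa.
- by rewrite cw_vertices_relabel in subA; rewrite !IHa.
Qed.

Lemma pairs_setI phi S A : cw_vertices phi \subset A ->
  pairs phi (S :&: A) = pairs phi S.
Proof.
elim: phi => [i v|a IHa b IHb|i j a IHa|i j a IHa] /= subA //.
- move: subA; rewrite cw_vertices_union subUset => /andP [subA subB].
  by rewrite IHa ?IHb.
- by rewrite !state_setI ?IHa.
- by rewrite cw_vertices_relabel in subA; rewrite !IHa.
Qed.

(** The equality case singles out the legal merges: one side is empty, or both sides are in state
    2. *)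
Lemma ones_union a b S :
  ones (CWunion a b) S <= ones a S + ones b S ?= iff
  [forall l, (state (CWunion a b) S l == 1) == (state a S l == 1) + (state b S l == 1)
     :> nat].
Proof.
rewrite /ones -big_split; apply: leqif_sum => l _; split=> //=.
by case: (state a S l) (state b S l) => [|[|p]] [|[|q]] //=; lia.
Qed.

(** Two classes in state 1 are traded for one pair, so twice the pairs plus the classes in state 1
    is invariant under joins; only merges can lose something. *)
Lemma ones_join (i j : 'I_k) a S : i != j ->
  ones (CWjoin i j a) S + ((state a S i == 1) && (state a S j == 1)).*2 = ones a S.
Proof.
move=> ne_ij; rewrite /ones /=.
case: (boolP ((state a S i == 1) && (state a S j == 1))) => [/andP [p1 q1]|npq].
  rewrite p1 q1 /= (bigD1 i) //= [in RHS](bigD1 i) //= eqxx p1.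
  rewrite (bigD1 j) 1?eq_sym //= [in RHS](bigD1 j) 1?eq_sym //= eqxx orbT q1.
  rewrite addnC; congr (_ + (_ + _)); apply: eq_bigr => l /andP [/negbTE -> /negbTE ->].
  by [].
rewrite addn0; apply: eq_bigr => l _; rewrite andbA (negbTE npq).
by [].
Qed.

Lemma ones_relabel (i j : 'I_k) a S : i != j ->
  ones (CWrelabel i j a) S +
    ((state a S i == 1) + (state a S j == 1) - (maxn (state a S i) (state a S j) == 1))
  = ones a S.
Proof.
move=> ne_ij; rewrite /ones /=.
rewrite (bigD1 i) //= [in RHS](bigD1 i) //= (negbTE ne_ij) eqxx.
rewrite (bigD1 j) 1?eq_sym //= [in RHS](bigD1 j) 1?eq_sym //= eqxx.
set r := \sum_(l < k | _) _; set r' := \sum_(l < k | _) _.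
have -> : r = r'.
  by apply: eq_bigr => l /andP [/negbTE -> /negbTE ->].
by case: (state a S i) (state a S j) => [|[|p]] [|[|q]] //=; lia.
Qed.

Lemma relabel_id (i : 'I_k) a S : state (CWrelabel i i a) S =1 state a S.
Proof. by move=> l /=; case: eqP => [->|] //; rewrite maxnn. Qed.

Lemma card_union_valid a b S : cw_valid (CWunion a b) ->
  #|S :&: cw_vertices (CWunion a b)| =
  #|S :&: cw_vertices a| + #|S :&: cw_vertices b|.
Proof.
move=> /and3P [dis _ _]; rewrite cw_vertices_union setIUr cardsU.
suff -> : S :&: cw_vertices a :&: (S :&: cw_vertices b) = set0.
  by rewrite cards0 subn0.
rewrite setIACA (disjoint_setI0 dis) setI0 //.
Qed.

(* Every illegal merge loses a class in state 1, so equality rules them out. *)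
Lemma admissible_ones phi S : cw_valid phi -> admissible phi S ->
  (pairs phi S).*2 + ones phi S <= #|S :&: cw_vertices phi|.
Proof.
elim: phi => [i v|a IHa b IHb|i j a IHa|i j a IHa].
- move=> _ _; rewrite /ones add0n (bigD1 i) //= big1 ?addn0 => [|l /negbTE ->].
    case: (boolP (v \in S)) => //= vS; rewrite eqxx card_gt0.
    by apply/set0Pn; exists v; rewrite !inE vS /= eqxx.
  by rewrite andbF.
- move=> Vab; rewrite card_union_valid //=; move: (Vab) => /and3P [_ Va Vb].
  move=> /andP [/(IHa Va) le_a /(IHb Vb) le_b].
  by have := (ones_union a b S).1; lia.
- move=> /= /andP [ne_ij Va] /andP [/(IHa Va) le_a _].
  by have := ones_join a S ne_ij; rewrite -[cw_vertices (CWjoin i j a)]/(cw_vertices a); lia.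
- move=> /= Va /(IHa Va); rewrite cw_vertices_relabel.
  have [<-|ne_ij] := eqVneq i j; last by have := ones_relabel a S ne_ij; lia.
  by rewrite /ones; under [in X in _ -> X]eq_bigr do rewrite relabel_id.
Qed.


(** * Sets attaining the counting bound, and the meaning of their states *)

Definition tight phi S : bool :=
  admissible phi S && (#|S :&: cw_vertices phi| == (pairs phi S).*2 + ones phi S).

Definition settled phi S : Prop := forall l,
  match state phi S l with
  | 0 => class phi S l = set0
  | 1 => exists2 v, class phi S l = [set v] & degree phi S v = 0
  | _ => class phi S l != set0 /\ {in class phi S l, forall v, degree phi S v = 1}
  end.

(** What an induced matching of the whole graph leaves in a subexpression. A vertex still without a
    partner must be alone in its class, since a later join treats the class as a whole. *)
Definition extendable phi S : Prop :=
  {in S, forall v, degree phi S v <= 1} /\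
  forall l v, v \in class phi S l -> degree phi S v = 0 -> class phi S l = [set v].

Lemma class_vertex phi S l v : v \in class phi S l -> v \in cw_vertices phi.
Proof. by rewrite !inE => /andP [_ /eqP ->]. Qed.

Lemma cw_edgeC phi : symmetric (cw_edge phi).
Proof.
elim: phi => [//|a IHa b IHb|i j a IHa|i j a IHa] x y /=.
- by rewrite IHa IHb.
- by rewrite IHa; congr (_ || _); rewrite orbC andbC [X in _ || X = _]andbC.
- exact: IHa.
Qed.

Lemma union_label a b v : cw_valid (CWunion a b) -> v \in cw_vertices b ->
  cw_label a v = None.
Proof.
move=> /and3P [dis _ _] vb; apply/eqP; apply: contraTT vb => va.
by rewrite (disjointFr dis) // inE.
Qed.

Lemma class_union a b S l : cw_valid (CWunion a b) ->
  class (CWunion a b) S l = class a S l :|: class b S l.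
Proof.
move=> Vab; apply/setP=> v; rewrite !inE /= -andb_orr; congr (_ && _).
case def_b: (cw_label b v) => [l'|]; last by case: (cw_label a v) => [?|]; rewrite ?orbF.
by rewrite (union_label Vab) // inE def_b.
Qed.

Lemma degree_unionl a b S v : cw_valid (CWunion a b) -> v \in cw_vertices a ->
  degree (CWunion a b) S v = degree a S v.
Proof.
move=> Vab va; apply: eq_card => u; rewrite !inE /=; congr (_ && _).
apply/orb_idr => /cw_edge_vertices /andP [vb _].
by move: va; rewrite inE (union_label Vab).
Qed.

Lemma degree_unionr a b S v : cw_valid (CWunion a b) -> v \in cw_vertices b ->
  degree (CWunion a b) S v = degree b S v.
Proof.
move=> Vab vb; apply: eq_card => u; rewrite !inE /=; congr (_ && _).
apply/orb_idl => /cw_edge_vertices /andP [].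
by rewrite inE (union_label Vab).
Qed.

Lemma class_relabel i j a S l : class (CWrelabel i j a) S l =
  if l == j then class a S i :|: class a S j
  else if l == i then set0 else class a S l.
Proof.
apply/setP=> v; case: (eqVneq l j) => [->|ne_lj].
  rewrite !inE /= -andb_orr; congr (_ && _).
  by case: (cw_label a v == Some i); rewrite ?eqxx.
case: (eqVneq l i) => [->|ne_li] in ne_lj *; rewrite !inE /=.
  case: ifP => [_|->]; last by rewrite andbF.
  by rewrite (inj_eq Some_inj) eq_sym (negbTE ne_lj) andbF.
case: ifP => // /eqP ->.
by rewrite !(inj_eq Some_inj) eq_sym (negbTE ne_lj) eq_sym (negbTE ne_li).
Qed.

Lemma nbrs_join i j a S v : i != j -> cw_label a v = Some i ->
  [set u in S | cw_edge (CWjoin i j a) v u] =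
  [set u in S | cw_edge a v u] :|: class a S j.
Proof.
move=> ne_ij lab_v; apply/setP=> u; rewrite !inE /= lab_v eqxx /=.
by rewrite (inj_eq Some_inj) (negbTE ne_ij) orbF -andb_orr.
Qed.

Lemma joinC_degree i j a S v : degree (CWjoin i j a) S v = degree (CWjoin j i a) S v.
Proof. by apply: eq_card => u; rewrite !inE /=; congr (_ && (_ || _)); rewrite orbC. Qed.

Lemma degree_join_other i j a S v :
  cw_label a v != Some i -> cw_label a v != Some j ->
  degree (CWjoin i j a) S v = degree a S v.
Proof.
move=> /negbTE ni /negbTE nj; apply: eq_card => u.
by rewrite !inE /= ni nj orbF.
Qed.

Lemma degree_join_leq i j a S v : degree a S v <= degree (CWjoin i j a) S v.
Proof.
apply: subset_leq_card; apply/subsetP=> u; rewrite !inE /= => /andP [-> ->] //.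
Qed.

Lemma degree_join_empty i j a S v : i != j ->
  class a S i = set0 -> v \in S -> degree (CWjoin i j a) S v = degree a S v.
Proof.
move=> ne_ij i0 vS.
have ni : cw_label a v != Some i.
  by apply/eqP=> lab_v; have := in_set0 v; rewrite -i0 !inE vS lab_v eqxx.
have [lab_v|nj] := eqVneq (cw_label a v) (Some j); last exact: degree_join_other.
by rewrite joinC_degree /degree nbrs_join 1?eq_sym // i0 setU0.
Qed.

Lemma state_eq0 phi S l : settled phi S -> (state phi S l == 0) = (class phi S l == set0).
Proof.
move/(_ l); case: (state phi S l) => [->|[[v -> _]|p [/negbTE -> _]]]; rewrite ?eqxx //.
by apply/esym/negbTE/set0Pn; exists v; rewrite set11.
Qed.

Lemma settled_join i j a S : i != j -> admissible (CWjoin i j a) S -> settled a S ->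
  settled (CWjoin i j a) S.
Proof.
move=> ne_ij /= /andP [_ ok] set_a l /=.
(* Unless both classes are in state 1, one of them is empty and the join adds no edge inside [S]. *)
have same : ~~ ((state a S i == 1) && (state a S j == 1)) ->
    {in S, forall v, degree (CWjoin i j a) S v = degree a S v}.
  move=> not11 v vS; move: ok; rewrite (negbTE not11) orbF => /orP [].
    by rewrite state_eq0 // => /eqP i0; apply: degree_join_empty.
  rewrite state_eq0 // => /eqP j0; rewrite joinC_degree.
  by apply: degree_join_empty; rewrite 1?eq_sym.
rewrite andbA; case: (boolP (_ && _ && _)) => [/andP [/andP [/eqP p1 /eqP q1] l_ij]|].
  have := set_a i; rewrite p1 => -[u iu u0].
  have := set_a j; rewrite q1 => -[w jw w0].
  have [lab_u lab_w] : cw_label a u = Some i /\ cw_label a w = Some j.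
    have: u \in class a S i by rewrite iu set11.
    have: w \in class a S j by rewrite jw set11.
    by rewrite !inE => /andP [_ /eqP ->] /andP [_ /eqP ->].
  have deg_u : degree (CWjoin i j a) S u = 1.
    rewrite /degree nbrs_join // jw; move/eqP: u0; rewrite cards_eq0 => /eqP ->.
    by rewrite set0U cards1.
  have deg_w : degree (CWjoin i j a) S w = 1.
    rewrite joinC_degree /degree nbrs_join 1?eq_sym // iu.
    move/eqP: w0; rewrite cards_eq0 => /eqP ->.
    by rewrite set0U cards1.
  by case/orP: l_ij => /eqP ->; rewrite -[class _ _ _]/(class a S _) ?iu ?jw;
    (split; first by apply/set0Pn; eexists; exact: set11); move=> v /set1P ->.
rewrite -[class (CWjoin i j a) S l]/(class a S l).
case: (boolP ((state a S i == 1) && (state a S j == 1))) => [/andP [p1 q1]|npq].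
  rewrite /= negb_or => /andP [ne_li ne_lj].
  have other v : v \in class a S l -> degree (CWjoin i j a) S v = degree a S v.
    rewrite inE => /andP [_ /eqP lab_v].
    by apply: degree_join_other; rewrite lab_v (inj_eq Some_inj).
  have := set_a l; case: (state a S l) => [//|[|p]].
    by case=> v lv v0; exists v => //; rewrite other // lv set11.
  by case=> ne l1; split=> // v lv; rewrite other ?l1.
move=> _; have := set_a l; case: (state a S l) => [//|[|p]].
  case=> v lv v0; exists v => //; rewrite same //.
  by have := set11 v; rewrite -lv inE => /andP [].
case=> ne l1; split=> // v lv; rewrite same ?l1 //.
by move: lv; rewrite inE => /andP [].
Qed.

Lemma settled_relabel i j a S : settled a S ->
  (i != j -> (maxn (state a S i) (state a S j) == 1) =
             (state a S i == 1) + (state a S j == 1) :> nat) ->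
  settled (CWrelabel i j a) S.
Proof.
move=> set_a; have [<- _|ne_ij /(_ isT) merge] := eqVneq i j => l.
  rewrite relabel_id class_relabel -[degree _ _]/(degree a S).
  by case: (eqVneq l i) => [->|_]; rewrite ?setUid; exact: set_a.
rewrite class_relabel /= -[degree _ _]/(degree a S).
case: (eqVneq l j) => [_|ne_lj]; last by case: (eqVneq l i) => // _; exact: set_a.
have := set_a i; have := set_a j; move: merge.
case: (state a S i) (state a S j) => [|[|p]] [|[|q]] //= _.
- by move=> -> ->; rewrite setU0.
- by move=> jw ->; rewrite set0U.
- by move=> jw ->; rewrite set0U.
- by move=> -> iw; rewrite setU0.
- by move=> -> iw; rewrite setU0.
rewrite maxnSS maxnSS => -[nj j1] [ni i1]; split.
  by rewrite setU_eq0 negb_and ni.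
by move=> v /setUP [/i1|/j1].
Qed.

Lemma settled_union a b S : cw_valid (CWunion a b) -> settled a S -> settled b S ->
  (forall l, (maxn (state a S l) (state b S l) == 1) =
             (state a S l == 1) + (state b S l == 1) :> nat) ->
  settled (CWunion a b) S.
Proof.
move=> Vab set_a set_b merge l; rewrite class_union //=.
have deg_a v : v \in class a S l -> degree (CWunion a b) S v = degree a S v.
  by move/class_vertex=> va; apply: degree_unionl.
have deg_b v : v \in class b S l -> degree (CWunion a b) S v = degree b S v.
  by move/class_vertex=> vb; apply: degree_unionr.
have := set_a l; have := set_b l; move: (merge l).
case: (state a S l) (state b S l) => [|[|p]] [|[|q]] //= _.
- by move=> -> ->; rewrite setU0.
- move=> [v lv v0] ->; exists v; first by rewrite set0U.
  by rewrite deg_b // lv set11.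
- by move=> [ne l1] ->; rewrite set0U; split=> // v lv; rewrite deg_b ?l1.
- move=> -> [v lv v0]; exists v; first by rewrite setU0.
  by rewrite deg_a // lv set11.
- by move=> -> [ne l1]; rewrite setU0; split=> // v lv; rewrite deg_a ?l1.
rewrite maxnSS maxnSS => -[nb b1] [na a1]; split.
  by rewrite setU_eq0 negb_and na.
by move=> v /setUP [lv|lv]; [rewrite deg_a ?a1 | rewrite deg_b ?b1].
Qed.

(** The bounds for [a], for [b] and for the number of classes in state 1 add up, so equality in the
    sum forces equality in each. *)
Lemma tight_union a b S : cw_valid (CWunion a b) ->
  tight (CWunion a b) S = [&& tight a S, tight b S & [forall l,
    (maxn (state a S l) (state b S l) == 1) ==
      (state a S l == 1) + (state b S l == 1) :> nat]].
Proof.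
move=> Vab; rewrite /tight card_union_valid //=; have /and3P [_ Va Vb] := Vab.
have [le_ab <-] := ones_union a b S.
case ad_a: (admissible a S); rewrite ?andbF //=.
case ad_b: (admissible b S); rewrite ?andbF //=.
have := admissible_ones Va ad_a; have := admissible_ones Vb ad_b; lia.
Qed.

Lemma tight_join i j a S : i != j -> tight (CWjoin i j a) S =
  tight a S && [|| state a S i == 0, state a S j == 0
        | (state a S i == 1) && (state a S j == 1)].
Proof.
move=> ne_ij; rewrite /tight -[cw_vertices (CWjoin i j a)]/(cw_vertices a) /=.
rewrite -(ones_join a S ne_ij) andbAC; congr (_ && _ && _); lia.
Qed.

Lemma tight_relabel i j a S : cw_valid a -> tight (CWrelabel i j a) S =
  tight a S && ((i != j) ==> ((maxn (state a S i) (state a S j) == 1) ==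
             (state a S i == 1) + (state a S j == 1) :> nat)).
Proof.
move=> Va; rewrite /tight cw_vertices_relabel /=; case: (eqVneq i j) => [<-|ne_ij] /=.
  by rewrite andbT /ones; under eq_bigr do rewrite relabel_id.
case ad_a: (admissible a S); rewrite ?andbF //=.
have := admissible_ones Va ad_a; rewrite -(ones_relabel a S ne_ij).
by case: (state a S i) (state a S j) => [|[|p]] [|[|q]] //=; lia.
Qed.

(** Equality passes to the subexpressions and excludes the illegal merges, the only operations on
    admissible sets that falsify the meaning of the states. *)
Lemma tight_settled phi S : cw_valid phi -> tight phi S -> settled phi S.
Proof.
elim: phi => [i v|a IHa b IHb|i j a IHa|i j a IHa] Vphi.
- move=> _ l /=.
  have class_l : class (CWvertex i v) S l = if (v \in S) && (l == i) then [set v] else set0.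
    apply/setP=> u; rewrite !inE /=; case: (eqVneq u v) => [->|ne_uv].
      by rewrite (inj_eq Some_inj) eq_sym; case: ifP; rewrite !inE ?eqxx.
    by rewrite andbF; case: ifP; rewrite !inE ?(negbTE ne_uv).
  rewrite class_l; case: (_ && _) => //=; exists v => //.
  by apply/eqP; rewrite cards_eq0; apply/eqP/setP=> u; rewrite !inE andbF.
- rewrite tight_union // => /and3P [Ta Tb /forallP merge].
  have /and3P [_ Va Vb] := Vphi.
  apply: settled_union => //; [exact: IHa|exact: IHb|].
  by move=> l; apply/eqP; apply: merge.
- move=> Tj; have /andP [ne_ij Va] := Vphi; have /andP [ok _] := Tj.
  by apply: settled_join => //; apply: IHa => //; move: Tj; rewrite tight_join // => /andP [].
- rewrite tight_relabel // => /andP [Ta merge]; apply: settled_relabel; first exact: IHa.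
  by move=> ne_ij; apply/eqP; move: merge; rewrite ne_ij.
Qed.

(** * Restricting induced matchings to subexpressions *)

Lemma extendable_join i j a S : i != j ->
  extendable (CWjoin i j a) S -> extendable a S.
Proof.
move=> ne_ij [deg1 alone]; split=> [v vS|l v lv v0].
  by apply: leq_trans (deg1 v vS); apply: degree_join_leq.
have [v0'|] := posnP (degree (CWjoin i j a) S v); first exact: (alone l).
case/card_gt0P=> u; rewrite inE => /andP [uS vu].
apply/eqP; rewrite eqEsubset sub1set lv andbT; apply/subsetP=> w lw; rewrite inE.
(* The join gives [v] a new partner [u]. Any other vertex [w] of the class becomes adjacent to [u]
   as well, which then has degree at least 2. *)
apply: contraTT (deg1 u uS) => ne_wv; rewrite -ltnNge.
have [vS lab_v] : v \in S /\ cw_label a v = Some l.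
  by move: lv; rewrite inE => /andP [? /eqP].
have [wS lab_w] : w \in S /\ cw_label a w = Some l.
  by move: lw; rewrite inE => /andP [? /eqP].
have no_a : cw_edge a v u = false.
  apply/negbTE; apply: contra_eqN v0 => vu'; rewrite -lt0n.
  by apply/card_gt0P; exists u; rewrite inE uS.
have wu : cw_edge (CWjoin i j a) w u.
  by move: vu; rewrite /= no_a lab_v lab_w /= => ->; rewrite orbT.
have := subset_leq_card (_ : [set v; w] \subset [set x in S | cw_edge (CWjoin i j a) u x]).
rewrite cards2 eq_sym ne_wv; apply.
by apply/subsetP=> x /set2P [->|->]; rewrite inE cw_edgeC ?vS ?wS.
Qed.

Lemma extendable_unionl a b S : cw_valid (CWunion a b) ->
  extendable (CWunion a b) S -> extendable a S.
Proof.
move=> Vab [deg1 alone]; split=> [v vS|l v lv v0].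
  apply: leq_trans (deg1 v vS); apply: subset_leq_card; apply/subsetP=> u.
  by rewrite !inE /= => /andP [-> ->].
apply/eqP; rewrite eqEsubset sub1set lv andbT -(alone l v) ?class_union //.
- exact: subsetUl.
- by rewrite inE lv.
- by rewrite degree_unionl // (class_vertex lv).
Qed.

Lemma extendable_unionr a b S : cw_valid (CWunion a b) ->
  extendable (CWunion a b) S -> extendable b S.
Proof.
move=> Vab [deg1 alone]; split=> [v vS|l v lv v0].
  apply: leq_trans (deg1 v vS); apply: subset_leq_card; apply/subsetP=> u.
  by rewrite !inE /= => /andP [-> ->]; rewrite orbT.
apply/eqP; rewrite eqEsubset sub1set lv andbT -(alone l v) ?class_union //.
- exact: subsetUr.
- by rewrite inE lv orbT.
- by rewrite degree_unionr // (class_vertex lv).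
Qed.

Lemma extendable_relabel i j a S :
  extendable (CWrelabel i j a) S -> extendable a S.
Proof.
move=> [deg1 alone]; split=> // l v lv v0.
have sub : class a S l \subset class (CWrelabel i j a) S (if l == i then j else l).
  rewrite class_relabel; have [->|ne_li] := eqVneq l i; first by rewrite eqxx subsetUl.
  by have [->|_] := eqVneq l j; [rewrite subsetUr | rewrite (negbTE ne_li)].
apply/eqP; rewrite eqEsubset sub1set lv andbT.
by rewrite -(alone _ v (subsetP sub v lv)).
Qed.

Lemma state_class phi S l : settled phi S -> state phi S l != 0 ->
  exists2 v, v \in class phi S l & degree phi S v = (state phi S l == 2).
Proof.
move/(_ l); have := state_le2 phi S l; case: (state phi S l) => [|[|[|//]]] //= _.
  by case=> v -> v0 _; exists v; rewrite ?set11.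
by case=> /set0Pn [v lv] l1 _; exists v; rewrite // l1.
Qed.

(** Each part shows that a vertex of the other part is not alone in the merged class, so neither
    vertex can be unmatched. *)
Lemma alone_merge phi S l (A B : {set T}) u w : extendable phi S ->
  class phi S l = A :|: B -> [disjoint A & B] -> u \in A -> w \in B ->
  (degree phi S u != 0) && (degree phi S w != 0).
Proof.
move=> [_ alone] def_l disAB uA wB.
have ne_uw : u != w by apply: contraTneq uA => ->; rewrite (disjointFl disAB).
have ul : u \in class phi S l by rewrite def_l inE uA.
have wl : w \in class phi S l by rewrite def_l inE wB orbT.
apply/andP; split; apply/eqP=> /alone.
  by move/(_ l ul)=> lu; move: wl; rewrite lu inE eq_sym (negbTE ne_uw).
by move/(_ l wl)=> lw; move: ul; rewrite lw inE (negbTE ne_uw).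
Qed.

(** Irredundancy enters here: the edge from [u] to [w] is new, so the degree of [u] really grows. *)
Lemma degree_join_irredundant i j a S u w : i != j ->
  cw_irredundant (CWjoin i j a) -> u \in class a S i -> w \in class a S j ->
  degree a S u < degree (CWjoin i j a) S u.
Proof.
move=> ne_ij /= /andP [/existsPn irr _]; rewrite !inE => /andP [uS /eqP iu] /andP [wS /eqP jw].
rewrite /degree nbrs_join //; apply: proper_card.
rewrite properE subsetUl; apply/subsetPn; exists w; first by rewrite !inE wS jw eqxx orbT.
by have /existsPn/(_ w) := irr u; rewrite !inE iu jw !eqxx wS.
Qed.

Lemma cw_irredundant_joinC i j a :
  cw_irredundant (CWjoin i j a) -> cw_irredundant (CWjoin j i a).
Proof.
move=> /= /andP [irr ->]; rewrite andbT; apply: contra irr.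
move=> /existsP [x /existsP [y /and3P [xj yi xy]]].
by apply/existsP; exists y; apply/existsP; exists x; rewrite xj yi cw_edgeC.
Qed.

(** A vertex of class [i] gains a neighbour in class [j] while its degree stays at most 1, so it was
    unmatched before. *)
Lemma extendable_join_state i j a S : i != j -> cw_irredundant (CWjoin i j a) ->
  extendable (CWjoin i j a) S -> settled a S ->
  state a S i != 0 -> state a S j != 0 -> state a S i == 1.
Proof.
move=> ne_ij irr [deg1 _] set_a pi pj.
have [u ui du] := state_class set_a pi; have [w wj dw] := state_class set_a pj.
have uS : u \in S by move: ui; rewrite inE => /andP [].
have := leq_trans (degree_join_irredundant ne_ij irr ui wj) (deg1 u uS).
by rewrite du; have := state_le2 a S i; case: (state a S i) pi => [|[|[|]]].
Qed.

(** By induction the parts are tight, hence settled, so their states can be read as degrees. The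
    degree bound and the aloneness of unmatched vertices then make each merge and each join
    legal. *)
Lemma extendable_tight phi S : cw_valid phi -> cw_irredundant phi ->
  extendable phi S -> tight phi S.
Proof.
elim: phi => [i v|a IHa b IHb|i j a IHa|i j a IHa] Vphi irr ext.
- rewrite /tight /= /ones add0n (bigD1 i) //= big1 => [|l /negbTE ->]; last by rewrite andbF.
  rewrite eqxx andbT addn0.
  have -> : cw_vertices (CWvertex i v) = [set v].
    by apply/setP=> u; rewrite !inE /=; case: (u == v).
  case: (boolP (v \in S)) => vS.
    by rewrite (setIidPr _) ?cards1 // sub1set.
  by rewrite (disjoint_setI0 _) ?cards0 // disjoint_sym disjoints1.
- have /and3P [dis Va Vb] := Vphi; have /andP [irr_a irr_b] := irr.
  have Ta := IHa Va irr_a (extendable_unionl Vphi ext).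
  have Tb := IHb Vb irr_b (extendable_unionr Vphi ext).
  rewrite tight_union // Ta Tb; apply/forallP=> l.
  have set_a := tight_settled Va Ta; have set_b := tight_settled Vb Tb.
  have [p0|p_gt0] := eqVneq (state a S l) 0; first by rewrite p0 max0n.
  have [q0|q_gt0] := eqVneq (state b S l) 0; first by rewrite q0 maxn0 addn0.
  have [u ul du] := state_class set_a p_gt0; have [w wl dw] := state_class set_b q_gt0.
  have := alone_merge ext (class_union S l Vphi) _ ul wl.
  rewrite degree_unionl ?degree_unionr ?(class_vertex ul) ?(class_vertex wl) // du dw.
  have -> : [disjoint class a S l & class b S l].
    by apply: disjointWl (disjointWr _ dis); apply/subsetP=> x /class_vertex.
  by move=> /(_ isT); rewrite !eqb0 !negbK => /andP [/eqP -> /eqP ->].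
- have /andP [ne_ij Va] := Vphi; have /andP [_ irr_a] := irr.
  have Ta := IHa Va irr_a (extendable_join ne_ij ext).
  have set_a := tight_settled Va Ta.
  rewrite tight_join // Ta /=.
  case: eqP => [//|/eqP p_gt0]; case: eqP => [//|/eqP q_gt0] /=.
  rewrite (extendable_join_state ne_ij irr) //=.
  apply: (@extendable_join_state j i) => //; first by rewrite eq_sym.
    exact: cw_irredundant_joinC.
  case: ext => deg1 alone; split=> [v vS|l v lv]; rewrite joinC_degree; first exact: deg1.
  exact: alone.
- have Ta := IHa Vphi irr (extendable_relabel ext).
  have set_a := @tight_settled a S Vphi Ta.
  rewrite tight_relabel // Ta; apply/implyP=> ne_ij.
  have [p0|p_gt0] := eqVneq (state a S i) 0; first by rewrite p0 max0n.
  have [q0|q_gt0] := eqVneq (state a S j) 0; first by rewrite q0 maxn0 addn0.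
  have [u ul du] := state_class set_a p_gt0; have [w wl dw] := state_class set_a q_gt0.
  have def_j := class_relabel i j a S j; rewrite eqxx in def_j.
  have := alone_merge ext def_j _ ul wl.
  rewrite -[degree (CWrelabel i j a) S]/(degree a S) du dw.
  have -> : [disjoint class a S i & class a S j].
    rewrite -setI_eq0; apply/eqP/setP=> x; rewrite !inE.
    apply/negbTE/negP=> /andP [/andP [_ /eqP ->] /andP [_ /eqP [eq_ij]]].
    by rewrite eq_ij eqxx in ne_ij.
  by move=> /(_ isT); rewrite !eqb0 !negbK => /andP [/eqP -> /eqP ->].
Qed.

(** If [S] has exactly two vertices per pair, the counting bound leaves no room for a class in state
    1, so every vertex of [S] is matched. Conversely, a 1-regular set is extendable, hence tight,
    and a class in state 1 would contain a vertex of degree 0. *)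
Lemma admissible_regular phi S : cw_valid phi -> cw_irredundant phi ->
  cw_vertices phi = [set: T] ->
  admissible phi S && (#|S| == (pairs phi S).*2) =
  [forall v in S, degree phi S v == 1].
Proof.
move=> Vphi irr full; apply/andP/forall_inP => [[ok /eqP cardS] v vS|reg].
  have T1 : tight phi S.
    rewrite /tight ok full setIT; have := admissible_ones Vphi ok.
    by rewrite full setIT; lia.
  have ones0 : ones phi S = 0.
    by move: T1; rewrite /tight full setIT ok; lia.
  have: v \in cw_vertices phi by rewrite full inE.
  rewrite inE; case lab_v: (cw_label phi v) => [l|//] _.
  have lv : v \in class phi S l by rewrite inE vS lab_v eqxx.
  have := tight_settled Vphi T1 l.
  have: (state phi S l == 1) = false.
    by move/eqP: ones0; rewrite sum_nat_eq0 => /forallP/(_ l) /=; rewrite eqb0 => /negbTE.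
  case: (state phi S l) => [|[|p]] //= _; first by move=> l0; rewrite l0 inE in lv.
  by case=> _ l1; apply/eqP; apply: l1.
have T1 : tight phi S.
  apply: extendable_tight => //; split=> [v vS|l v]; first by rewrite (eqP (reg v vS)).
  by rewrite inE => /andP [vS _] v0; have := reg v vS; rewrite v0.
have ones0 : ones phi S = 0.
  apply/eqP; rewrite sum_nat_eq0; apply/forallP=> l /=; rewrite eqb0.
  apply/eqP=> p1; have := tight_settled Vphi T1 l; rewrite p1 => -[v lv v0].
  have: v \in class phi S l by rewrite lv set11.
  by rewrite inE => /andP [vS _]; have := reg v vS; rewrite v0.
by move: T1 => /andP [ok]; rewrite full setIT ones0 addn0.
Qed.
End PartialSolutions.

(** * The generating function of the partial solutions *)

Lemma card_sets (T : finType) : #|{set T}| = 2 ^ #|T|.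
Proof. by rewrite -(cardsT T) -card_powerset powersetT cardsT. Qed.

Section GenFun.
Variables (T : finType) (k y x : nat).
Implicit Types (phi a b : cwexpr T k) (S A B : {set T}) (l i j : 'I_k) (s : seq nat).

(** Positions past the end of [s] read as 0. Labels from [depth phi] on always stay in state 0, so
    vectors of that length suffice. *)
Definition below phi S s : bool := [forall l, state phi S l <= nth 0 s l].

Definition weight phi S : nat := y ^ #|S| * x ^ pairs phi S.

Definition genfun phi s : nat :=
  \sum_(S : {set T} | [&& S \subset cw_vertices phi, admissible phi S & below phi S s])
    weight phi S.

Lemma genfun_vertex i v s :
  genfun (CWvertex i v) s = if 0 < nth 0 s i then y.+1 else 1.
Proof.
have V : cw_vertices (CWvertex i v) = [set v].
  by apply/setP=> u; rewrite !inE /=; case: (u == v).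
rewrite /genfun V /= (bigD1 set0) /=; last first.
  by rewrite sub0set; apply/forallP=> l /=; rewrite inE.
rewrite /weight cards0 /=.
have below_v : below (CWvertex i v) [set v] s = (0 < nth 0 s i).
  apply/forallP/idP => [/(_ i)|si_gt0 l] /=; first by rewrite set11 eqxx.
  by rewrite set11; case: eqP => // ->.
case: ifP => si.
  rewrite (bigD1 [set v]) /=; last first.
    by rewrite subxx below_v si -card_gt0 cards1.
  rewrite cards1 expn1 expn0 !muln1 big1 ?addn0 ?add1n // => S.
  by rewrite subset1 => /andP [/andP [/andP [/orP [/eqP ->|/eqP ->]]]]; rewrite !eqxx.
rewrite big1 // => S /andP [/andP [+ bel] S0]; rewrite subset1 (negbTE S0) orbF => /eqP SV.
by move: bel; rewrite SV below_v si.
Qed.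

(** If [i] and [j] differ, the new class [i] is empty and its bound is void, while both old classes
    are bounded by the entry at [j]. *)
Lemma genfun_relabel i j a s :
  genfun (CWrelabel i j a) s = genfun a (set_nth 0 s i (nth 0 s j)).
Proof.
apply: eq_bigl => S; rewrite cw_vertices_relabel; congr [&& _, _ & _].
apply/forallP/forallP=> le_s l /=.
  rewrite nth_set_nth /=; case: eqP => [/val_inj ->|].
    by have := le_s j; rewrite /= eqxx geq_max => /andP [].
  move=> ne_li; have := le_s l; rewrite /=; case: eqP => [->|_].
    by rewrite geq_max => /andP [].
  by case: eqP => // eq_li; rewrite eq_li in ne_li.
case: eqP => [->|ne_lj].
  rewrite geq_max; have := le_s i; rewrite nth_set_nth /= eqxx => ->.
  by have := le_s j; rewrite nth_set_nth /=; case: eqP => [/val_inj ->|].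
case: eqP => // ne_li; have := le_s l; rewrite nth_set_nth /=.
by case: eqP => // /val_inj.
Qed.

Lemma big_subset_union (A B : {set T}) (f g : {set T} -> nat) : [disjoint A & B] ->
  \sum_(S : {set T} | S \subset A :|: B) f (S :&: A) * g (S :&: B) =
  (\sum_(S : {set T} | S \subset A) f S) * (\sum_(S : {set T} | S \subset B) g S).
Proof.
move=> dis; rewrite big_distrlr pair_big /=.
rewrite (reindex_onto (fun S => (S :&: A, S :&: B)) (fun p => p.1 :|: p.2)) /=.
  apply: eq_bigl => S; rewrite !subsetIr -setIUr /=.
  by apply/idP/eqP => [/setIidPl|/setIidPl].
move=> [S1 S2] /= /andP [S1A S2B]; rewrite !setIUl.
rewrite (setIidPl S1A) (setIidPl S2B).
have -> : S2 :&: A = set0.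
  by apply: disjoint_setI0; rewrite disjoint_sym; apply: disjointWr dis.
have -> : S1 :&: B = set0 by apply: disjoint_setI0; apply: disjointWl dis.
by rewrite setU0 set0U.
Qed.

(** The condition [maxn p q <= r] splits into [p <= r] and [q <= r], and the weight is
    multiplicative when [S] is cut along the two disjoint vertex sets. *)
Lemma genfun_union a b s : cw_valid (CWunion a b) ->
  genfun (CWunion a b) s = genfun a s * genfun b s.
Proof.
move=> Vab; have /and3P [dis _ _] := Vab.
rewrite /genfun !big_mkcondr -big_subset_union //.
rewrite cw_vertices_union; apply: eq_bigr => S subS.
rewrite !admissible_setI ?subxx //.
have bel c : below c (S :&: cw_vertices c) s = below c S s.
  by apply: eq_forallb => l; rewrite state_setI.
have -> : below (CWunion a b) S s = below a S s && below b S s.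
  apply/forallP/andP=> [le_s|[/forallP le_a /forallP le_b] l]; last first.
    by rewrite /= geq_max le_a le_b.
  by split; apply/forallP=> l; have := le_s l; rewrite /= geq_max => /andP [].
rewrite !bel /=.
case: (admissible a S) (admissible b S) (below a S s) (below b S s) => [] [] [] [] //=;
  rewrite ?muln0 //.
rewrite /weight !pairs_setI //= mulnACA -!expnD -card_union_valid //.
by rewrite cw_vertices_union (setIidPl subS).
Qed.

(** * Inclusion-exclusion for joins *)

Section GenFunJoin.
Variables (i j : 'I_k) (a : cwexpr T k) (s : seq nat).
Hypothesis ne_ij : i != j.

(** Coordinates [i] and [j] are freed and replaced by a coefficient depending on their states. Every
    term of the join formula has this shape, so identities reduce to comparing coefficients at
    states [p, q <= 2]. *)
Let J (c : nat -> nat -> nat) : nat :=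
  \sum_(S : {set T} | [&& S \subset cw_vertices a, admissible a S &
      [forall l, (l != i) && (l != j) ==> (state a S l <= nth 0 s l)]])
    c (state a S i) (state a S j) * weight a S.

Let J_add c c' : J c + J c' = J (fun p q => c p q + c' p q).
Proof. by rewrite /J -big_split; apply: eq_bigr => S _; rewrite mulnDl. Qed.

Let J_mul z c : z * J c = J (fun p q => z * c p q).
Proof. by rewrite /J big_distrr /=; apply: eq_bigr => S _; rewrite mulnA. Qed.

Let eq_J c c' : (forall p q, p <= 2 -> q <= 2 -> c p q = c' p q) -> J c = J c'.
Proof. by move=> eqc; apply: eq_bigr => S _; rewrite eqc ?state_le2. Qed.

Let genfun_J s' : (forall l, l != i -> l != j -> nth 0 s' l = nth 0 s l) ->
  genfun a s' = J (fun p q => (p <= nth 0 s' i) && (q <= nth 0 s' j)).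
Proof.
move=> eqs; rewrite /genfun /J big_mkcond [RHS]big_mkcond; apply: eq_bigr => S _.
have -> : below a S s' = [&& [forall l, (l != i) && (l != j) ==> (state a S l <= nth 0 s l)],
    state a S i <= nth 0 s' i & state a S j <= nth 0 s' j].
  apply/forallP/and3P=> [le_s|[/forallP le_s le_i le_j] l].
    split=> //; apply/forallP=> l; apply/implyP=> /andP [ne_li ne_lj].
    by rewrite -eqs.
  have [->//|ne_li] := eqVneq l i; have [->//|ne_lj] := eqVneq l j.
  by have := le_s l; rewrite ne_li ne_lj eqs.
case: (_ \subset _) => //=; case: (admissible _ _) => //=.
by case: [forall l, _] => //=; case: (_ && _); rewrite ?mul1n ?mul0n.
Qed.

Let F (p q : nat) := genfun a (set_nth 0 (set_nth 0 s j q) i p).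

Let nth_i p q : nth 0 (set_nth 0 (set_nth 0 s j q) i p) i = p.
Proof. by rewrite nth_set_nth /= eqxx. Qed.

Let nth_j p q : nth 0 (set_nth 0 (set_nth 0 s j q) i p) j = q.
Proof.
by rewrite nth_set_nth /= (inj_eq val_inj) eq_sym (negbTE ne_ij) nth_set_nth /= eqxx.
Qed.

Let F_J p0 q0 : F p0 q0 = J (fun p q => (p <= p0) && (q <= q0)).
Proof.
rewrite /F genfun_J ?nth_i ?nth_j // => l ne_li ne_lj.
rewrite nth_set_nth /= (inj_eq val_inj) (negbTE ne_li) nth_set_nth /=.
by rewrite (inj_eq val_inj) (negbTE ne_lj).
Qed.

Let Fi_J : genfun a (set_nth 0 s i 0) = J (fun p q => (p <= 0) && (q <= nth 0 s j)).
Proof.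
rewrite genfun_J => [|l ne_li ne_lj].
  by rewrite !nth_set_nth /= eqxx (inj_eq val_inj) eq_sym (negbTE ne_ij).
by rewrite !nth_set_nth /= !(inj_eq val_inj) (negbTE ne_li).
Qed.

Let Fj_J : genfun a (set_nth 0 s j 0) = J (fun p q => (p <= nth 0 s i) && (q <= 0)).
Proof.
rewrite genfun_J => [|l ne_li ne_lj].
  by rewrite !nth_set_nth /= eqxx (inj_eq val_inj) (negbTE ne_ij).
by rewrite !nth_set_nth /= !(inj_eq val_inj) (negbTE ne_lj).
Qed.

Let join_J : genfun (CWjoin i j a) s = J (fun p q =>
  ((p == 0) || (q == 0)) && (p <= nth 0 s i) && (q <= nth 0 s j) +
  x * [&& p == 1, q == 1, 2 <= nth 0 s i & 2 <= nth 0 s j]).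
Proof.
rewrite /genfun /J big_mkcond [RHS]big_mkcond; apply: eq_bigr => S _.
rewrite -[cw_vertices (CWjoin i j a)]/(cw_vertices a).
case: (_ \subset _) => //=; case: (admissible _ _) => //=.
set R := [forall l, _].
have -> : below (CWjoin i j a) S s = [&& R,
    state (CWjoin i j a) S i <= nth 0 s i & state (CWjoin i j a) S j <= nth 0 s j].
  apply/forallP/and3P=> [le_s|[/forallP le_s le_i le_j] l].
    split=> //; apply/forallP=> l; apply/implyP=> /andP [ne_li ne_lj].
    by have := le_s l; rewrite /= (negbTE ne_li) (negbTE ne_lj) !andbF.
  have [->//|ne_li] := eqVneq l i; have [->//|ne_lj] := eqVneq l j.
  by have := le_s l; rewrite ne_li ne_lj /= (negbTE ne_li) (negbTE ne_lj) !andbF.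
case: R; last by rewrite andbF.
rewrite /weight /= !eqxx orbT !andbT /=.
have := state_le2 a S i; have := state_le2 a S j.
case: (state a S i) (state a S j) => [|[|[|//]]] [|[|[|//]]] //= _ _;
  rewrite ?addn0 ?muln0 ?add0n ?mul1n ?andbT ?andTb //=.
all: try by [case: (_ < _); rewrite ?mul1n ?mul0n | case: (_ && _); rewrite ?mul1n ?mul0n].
by case: (_ && _); rewrite ?muln1 ?muln0 ?mul0n // expnD expn1 mulnA mulnC.
Qed.

(** This lemma and the next ensure that the truncated subtractions in the join formula are exact. *)
Lemma genfun_join_sub0 :
  F 0 0 <= genfun a (set_nth 0 s i 0) + genfun a (set_nth 0 s j 0).
Proof.
rewrite F_J Fi_J Fj_J J_add leq_sum // => S _; rewrite leq_mul2r; apply/orP; right.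
by case: (state a S i) (state a S j) => [|p] [|q].
Qed.

Lemma genfun_join_sub1 : F 0 1 + F 1 0 <= F 1 1 + F 0 0.
Proof.
rewrite !F_J !J_add leq_sum // => S _; rewrite leq_mul2r; apply/orP; right.
by case: (state a S i) (state a S j) => [|[|p]] [|[|q]].
Qed.

Lemma genfun_join : nth 0 s i <= 2 -> nth 0 s j <= 2 ->
  genfun (CWjoin i j a) s =
  (genfun a (set_nth 0 s i 0) + genfun a (set_nth 0 s j 0) - F 0 0) +
  (if nth 0 s j == 2 then
     if nth 0 s i == 2 then x * (F 1 1 + F 0 0 - (F 0 1 + F 1 0)) else 0
   else 0).
Proof.
move=> le_i le_j.
(* The product of the differences [[p <= 1] - [p <= 0]] and [[q <= 1] - [q <= 0]] isolates
   [p = q = 1]. *)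
have -> : F 1 1 + F 0 0 - (F 0 1 + F 1 0) = J (fun p q => (p == 1) && (q == 1)).
  apply/eqP; rewrite -(eqn_add2r (F 0 1 + F 1 0)) subnK ?genfun_join_sub1 //.
  rewrite !F_J !J_add; apply/eqP/eq_J => p q.
  by case: p q => [|[|[|//]]] [|[|[|//]]].
have -> : (if nth 0 s j == 2 then
     if nth 0 s i == 2 then x * J (fun p q => (p == 1) && (q == 1)) else 0 else 0) =
   J (fun p q => x * [&& p == 1, q == 1, 2 <= nth 0 s i & 2 <= nth 0 s j]).
  rewrite -J_mul; case: (nth 0 s i) (nth 0 s j) le_i le_j => [|[|[|//]]] [|[|[|//]]] //= _ _.
  all: try by rewrite [J _]big1 ?muln0 // => S _; rewrite !andbF.
  by congr (_ * _); apply: eq_J => p q _ _; rewrite !andbT.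
(* What remains is inclusion-exclusion for the condition [p = 0] or [q = 0]. *)
rewrite join_J -J_add; congr (_ + _).
apply/eqP; rewrite -(eqn_add2r (F 0 0)) subnK ?genfun_join_sub0 //.
rewrite F_J Fi_J Fj_J !J_add; apply/eqP/eq_J => p q _ _.
by case: p q => [|p] [|q]; rewrite ?andbT ?andbF ?orbT ?addn0 //=.
Qed.

End GenFunJoin.

Lemma pairs_leq phi S : cw_valid phi -> admissible phi S -> pairs phi S <= #|T|.
Proof.
move=> Vphi /(admissible_ones Vphi) le_card.
have : #|S :&: cw_vertices phi| <= #|T| := max_card _; lia.
Qed.

(** There are at most [2 ^ #|T|] sets, each with at most [#|T|] vertices and pairs. The bound is
    crude, but only its number of bits matters. *)
Lemma genfun_leq phi s : cw_valid phi -> 0 < y -> 0 < x ->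
  genfun phi s <= 2 ^ #|T| * (y * x) ^ #|T|.
Proof.
move=> Vphi y_gt0 x_gt0; apply: (@leq_trans (\sum_(S : {set T}) (y * x) ^ #|T|)).
  rewrite /genfun big_mkcond; apply: leq_sum => S _; case: ifP => // /and3P [_ ok _].
  rewrite expnMn; apply: leq_mul; apply: leq_pexp2l => //; first exact: max_card.
  exact: pairs_leq.
by rewrite sum_nat_const card_sets.
Qed.

End GenFun.

(** * Coefficients as digits *)

Lemma digit_sum (I : finType) (P : pred I) (f : I -> nat) B m : #|P| < B ->
  (\sum_(i | P i) B ^ f i) %/ B ^ m %% B = #|[pred i | P i && (f i == m)]|.
Proof.
move=> lt_B; have B_gt0 : 0 < B by apply: leq_ltn_trans lt_B.
rewrite (bigID (fun i => f i < m)) /= [X in _ + X](bigID (fun i => f i == m)) /=.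
set lo := \sum_(i | _) _; set mid := \sum_(i | _) _; set hi := \sum_(i | _) _.
have def_mid : mid = #|[pred i | P i && (f i == m)]| * B ^ m.
  rewrite -sum_nat_const /mid; apply: eq_big => [i|i]; last by case/andP=> _ /eqP ->.
  by rewrite inE /=; case: ltngtP; rewrite ?andbT ?andbF.
have /dvdnP [h def_hi] : B ^ m.+1 %| hi.
  apply: dvdn_sum => i /andP [/andP [_ ge_m] ne_m]; apply: dvdn_exp2l.
  by rewrite ltn_neqAle eq_sym ne_m leqNgt ge_m.
(* No carry comes from below: fewer than [B] terms are added, each at most [B ^ m.-1]. For [m = 0]
   the sum is empty. *)
have lt_lo : lo < B ^ m.
  case: m @lo {def_hi def_mid mid hi} => [|m] lo.
    by rewrite /lo big_pred0 // => i; rewrite andbF.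
  apply: (@leq_ltn_trans (#|P| * B ^ m)); last by rewrite expnS ltn_pmul2r ?expn_gt0 ?B_gt0.
  rewrite -sum_nat_const /lo (bigID (fun i => f i < m.+1) P) /= -[leqLHS]addn0 leq_add //.
  by apply: leq_sum => i /andP [_ lt_m]; apply: leq_pexp2l.
rewrite def_mid def_hi expnS mulnA -mulnDl addnC divnMDl ?expn_gt0 ?B_gt0 //.
rewrite (divn_small lt_lo) addn0 addnC modnMDl modn_small //.
apply: leq_ltn_trans lt_B; apply: subset_leq_card; apply/subsetP=> i.
by rewrite !inE => /andP [].
Qed.

(** * Induced matchings *)

Section Matchings.
Variables (T : finType) (e : rel T).
Hypotheses (e_sym : symmetric e) (e_irr : irreflexive e).
Implicit Types (M : {set {set T}}) (S : {set T}).

Definition regular1 S : bool := [forall v in S, #|[set u in S | e v u]| == 1].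

Definition edges_in S : {set {set T}} := [set A in edges e | A \subset S].

Lemma edgesP A : reflect (exists x y, e x y /\ A = [set x; y]) (A \in edges e).
Proof.
rewrite inE; apply: (iffP existsP) => [[x /existsP [y /andP [xy /eqP ->]]]|[x [y [xy ->]]]].
  by exists x, y.
by exists x; apply/existsP; exists y; rewrite xy eqxx.
Qed.

Lemma regular1_unique S v u w : regular1 S -> v \in S -> u \in S -> w \in S ->
  e v u -> e v w -> u = w.
Proof.
move=> /forall_inP reg vS uS wS vu vw; have /cards1P [z nz] := reg v vS.
have: u \in [set u in S | e v u] by rewrite inE uS.
have: w \in [set u in S | e v u] by rewrite inE wS.
by rewrite nz !inE => /eqP -> /eqP ->.
Qed.

Lemma edge_of_vertex S A v : A \in edges_in S -> v \in A ->
  exists2 u, A = [set v; u] & [/\ v \in S, u \in S & e v u].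
Proof.
rewrite inE => /andP [/edgesP [x [y [xy ->]]]]; rewrite subUset !sub1set => /andP [xS yS].
case/set2P=> ->; first by exists y.
by exists x; rewrite 1?setUC // e_sym.
Qed.

(** An edge inside [cover M] joins a vertex to its only neighbour there, which is its partner in
    [M]. Hence [cover] is injective on induced matchings. *)
Lemma induced_matching_edges M : induced_matching e M -> M = edges_in (cover M).
Proof.
move=> /andP [/andP [/subsetP Me triv] reg]; apply/setP=> A; apply/idP/idP => [AM|].
  by rewrite inE Me // (bigcup_max A).
rewrite inE => /andP [/edgesP [x [y [xy ->]]]]; rewrite subUset !sub1set => /andP [xM yM].
have /bigcupP [B BM xB] := xM.
have BE : B \in edges_in (cover M) by rewrite inE Me // (bigcup_max B).
have [z def_B [_ zM xz]] := edge_of_vertex BE xB.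
by rewrite (regular1_unique reg xM yM zM xy xz) -def_B.
Qed.

Lemma cover_edges_in S : regular1 S -> cover (edges_in S) = S.
Proof.
move=> reg; apply/setP=> v; apply/bigcupP/idP => [[A AE vA]|vS].
  by have [u _ []] := edge_of_vertex AE vA.
have /forall_inP/(_ v vS)/cards1P [u nu] := reg.
have: u \in [set u in S | e v u] by rewrite nu set11.
rewrite inE => /andP [uS vu]; exists [set v; u]; last by rewrite set21.
by rewrite inE subUset !sub1set vS uS !andbT; apply/edgesP; exists v, u.
Qed.

Lemma edges_in_induced S : regular1 S -> induced_matching e (edges_in S).
Proof.
move=> reg; rewrite /induced_matching cover_edges_in // [X in _ && X]reg andbT.
apply/andP; split; first by apply/subsetP=> A; rewrite inE => /andP [].
apply/trivIsetP=> A B AE BE ne_AB; rewrite -setI_eq0; apply: contraNT ne_AB.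
case/set0Pn=> v /setIP [vA vB].
have [u -> [vS uS vu]] := edge_of_vertex AE vA.
have [w -> [_ wS vw]] := edge_of_vertex BE vB.
by rewrite (regular1_unique reg vS uS wS vu vw).
Qed.

Lemma card_cover_matching M : induced_matching e M -> #|cover M| = #|M|.*2.
Proof.
move=> /andP [/andP [/subsetP Me /eqP <-] _].
rewrite (eq_bigr (fun=> 2)) ?sum_nat_const ?muln2 // => A /Me /edgesP [x [y [xy ->]]].
by rewrite cards2; case: eqP xy => // ->; rewrite e_irr.
Qed.

(** The bijection is [cover], with inverse [edges_in]. *)
Lemma num_induced_matchingsE l :
  num_induced_matchings e l = #|[set S | regular1 S && (#|S| == l.*2)]|.
Proof.
rewrite /num_induced_matchings -(card_in_imset (f := @cover T)) => [|M N]; last first.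
  rewrite !inE => /andP [iM _] /andP [iN _] eqMN.
  by rewrite (induced_matching_edges iM) (induced_matching_edges iN) eqMN.
apply: eq_card => S; apply/imsetP/idP => [[M]|].
  rewrite !inE => /andP [iM /eqP <-] ->; rewrite card_cover_matching // eqxx andbT.
  by case/andP: iM.
rewrite inE => /andP [reg cardS]; exists (edges_in S); last by rewrite cover_edges_in.
have iM := edges_in_induced reg; rewrite inE iM /=.
by move: cardS; rewrite -{1}(cover_edges_in reg) card_cover_matching // (inj_eq double_inj).
Qed.

End Matchings.

(** A set contributes [B] to the power [#|S| + (#|T| + 1) * pairs phi S]. The number of sets is
    below [B], so the digits count the sets by exponent. Position [l * (#|T| + 3)] is the exponent
    for [2 l] vertices and [l] pairs. *)
Lemma genfun_digit (T : finType) k (e : rel T) (phi : cwexpr T k) s l :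
  symmetric e -> irreflexive e -> cw_valid phi -> cw_irredundant phi ->
  cw_describes phi e -> (forall S, below phi S s) -> l <= #|T|./2 ->
  let B := 2 ^ #|T|.+1 in
  genfun B (B ^ #|T|.+1) phi s %/ B ^ (l * (#|T| + 3)) %% B = num_induced_matchings e l.
Proof.
move=> e_sym e_irr Vphi irr [full edge] bel le_l B.
have -> : genfun B (B ^ #|T|.+1) phi s =
    \sum_(S : {set T} | admissible phi S) B ^ (#|S| + #|T|.+1 * pairs phi S).
  by apply: eq_big => S; rewrite ?full ?subsetT ?bel ?andbT // /weight -expnM -expnD.
rewrite digit_sum; last first.
  apply: leq_ltn_trans (max_card _) _; rewrite card_sets /B.
  by rewrite ltn_exp2l.
rewrite num_induced_matchingsE //; apply: eq_card => S; rewrite !inE.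
have -> : regular1 e S = admissible phi S && (#|S| == (pairs phi S).*2).
  rewrite admissible_regular //; apply: eq_forallb => v; congr (_ ==> (_ == _)).
  by apply: eq_card => u; rewrite !inE edge.
case: (admissible phi S) => //=; have : #|S| <= #|T| := max_card _.
move: (pairs phi S) (#|S|) (#|T|) le_l => p m n le_l le_mn.
have le_ln : l.*2 <= n by lia.
(* As [m] and [2 l] are at most [n], equal exponents mean equal expansions in base [n + 1], so
   [p = l] and [m = 2 l]. *)
apply/eqP/andP => [eq1|[/eqP m2p /eqP m2l]]; last by nia.
have : p = l by nia.
by move=> pl; split; apply/eqP; nia.
Qed.

(** * Correctness and running time of the program *)

Lemma states_nth d s i : states d s -> nth 0 s i <= 2.
Proof.
move=> /andP [_ /allP s_le2]; case: (ltnP i (size s)) => [lt_i|ge_i].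
  by apply: s_le2; rewrite mem_nth.
by rewrite nth_default.
Qed.

Lemma nth_pick2 (H : seq nat -> nat) a s :
  nth (fun=> 0) [:: fun=> 0; fun=> 0; H] a s = if a == 2 then H s else 0.
Proof. by case: a => [|[|[|a]]] //=; rewrite nth_nil. Qed.

(** Since [M] bounds all entries, intermediate values are at most [2 M + 2 x M <= 4 x M]. The last
    two hypotheses make the subtractions legal for [f_sub]. *)
Lemma run_join L M d i j x F : i < d -> j < d -> 0 < x -> 0 < M ->
  (forall s, F s <= M) -> 4 * x * M < 2 ^ L ->
  (forall s, F (set_nth 0 (set_nth 0 s j 0) i 0) <=
             F (set_nth 0 s i 0) + F (set_nth 0 s j 0)) ->
  (forall s, F (set_nth 0 (set_nth 0 s j 1) i 0) + F (set_nth 0 (set_nth 0 s j 0) i 1) <=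
             F (set_nth 0 (set_nth 0 s j 1) i 1) + F (set_nth 0 (set_nth 0 s j 0) i 0)) ->
  run f_join
    (Node (unary d) (Node (enc_nat x) (Node (unary i) (Node (unary j) (table d F)))))
    (table d (fun s =>
      let G p q := F (set_nth 0 (set_nth 0 s j q) i p) in
      (F (set_nth 0 s i 0) + F (set_nth 0 s j 0) - G 0 0) +
      (if nth 0 s j == 2 then
         if nth 0 s i == 2 then x * (G 1 1 + G 0 0 - (G 0 1 + G 1 0)) else 0
       else 0)))
    (3 ^ d * (3000 * L.+1 ^ 3)).
Proof.
move=> lt_i lt_j x_gt0 M_gt0 le_M lt_L sub0 sub1.
have lt_4M : 4 * M < 2 ^ L by apply: leq_ltn_trans lt_L; nia.
have lt_x : x < 2 ^ L by apply: leq_ltn_trans lt_L; nia.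
have lt_xM n : n <= 2 * M -> x * n < 2 ^ L by move=> le_n; apply: leq_ltn_trans lt_L; nia.
have lt_xMM n m : n <= 2 * M -> m <= 2 * M -> n + x * m < 2 ^ L.
  by move=> le_n le_m; apply: leq_ltn_trans lt_L; nia.
run_steps ltac:(first [apply: (@run_set _ 0) | apply: (@run_set _ 1)
  | apply: (@run_zip L OpAdd) | apply: (@run_zip L OpSub) | apply: (@run_zip L OpMul)
  | apply: (@run_const _ 0) | apply: run_const | apply: run_pick]) => //.
all: try
  (move=> s ss; move: (sub0 s) (sub1 s) (le_M (set_nth 0 s i 0)) (le_M (set_nth 0 s j 0));
   have := le_M (set_nth 0 (set_nth 0 s j 0) i 0);
   have := le_M (set_nth 0 (set_nth 0 s j 0) i 1);
   have := le_M (set_nth 0 (set_nth 0 s j 1) i 0);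
   have := le_M (set_nth 0 (set_nth 0 s j 1) i 1);
   rewrite /binop_dom /=).
- lia.
- lia.
- lia.
- lia.
- lia.
- by move=> *; rewrite lt_x lt_xM; lia.
- move=> *; rewrite (nth_pick2 _ (nth 0 s j)) (nth_pick2 _ (nth 0 s i)) !andbT.
  case: (nth 0 s j == 2); last by lia.
  case: (nth 0 s i == 2); last by lia.
  by rewrite lt_xM ?lt_xMM; lia.
- by apply: eq_table => s _; rewrite /= (nth_pick2 _ (nth 0 s j)) (nth_pick2 _ (nth 0 s i)).
have lt_d : d < 3 ^ d by apply: ltn_expl.
have le_dL : 3 ^ d <= 3 ^ d * L.+1 ^ 3 by rewrite leq_pmulr // expn_gt0.
rewrite (mulnCA _ 3000) !(mulnCA _ 200).
move: (3 ^ d) (3 ^ d * L.+1 ^ 3) le_dL lt_d {sub0 sub1 lt_xM lt_xMM} => c c' le_c lt_d.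
lia.
Qed.

Fixpoint depth (T : Type) (k : nat) (phi : cwexpr T k) : nat :=
  match phi with
  | CWvertex i _ => i.+1
  | CWunion a b => maxn (depth a) (depth b)
  | CWjoin i j a | CWrelabel i j a => maxn i.+1 (maxn j.+1 (depth a))
  end.

Lemma depth_leq T k (phi : cwexpr T k) : depth phi <= k.
Proof.
by elim: phi => [i v|a IHa b IHb|i j a IHa|i j a IHa] /=; rewrite ?geq_max ?IHa ?IHb ?ltn_ord.
Qed.

Lemma state_depth (T : finType) k (phi : cwexpr T k) S (l : 'I_k) :
  depth phi <= l -> state phi S l = 0.
Proof.
elim: phi => [i v|a IHa b IHb|i j a IHa|i j a IHa] /=; rewrite ?geq_max.
- by move=> lt_il; case: eqP => [eq_li|_]; [rewrite eq_li ltnn in lt_il | rewrite andbF].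
- by move=> /andP [/IHa -> /IHb ->].
- case/and3P=> lt_il lt_jl /IHa ->.
  have -> : (l == i) = false by apply/eqP=> eq_li; rewrite eq_li ltnn in lt_il.
  have -> : (l == j) = false by apply/eqP=> eq_lj; rewrite eq_lj ltnn in lt_jl.
  by rewrite !andbF.
- case/and3P=> lt_il lt_jl /IHa ->.
  have -> : (l == j) = false by apply/eqP=> eq_lj; rewrite eq_lj ltnn in lt_jl.
  by case: ifP.
Qed.

Lemma enc_tagE :
  (enc_nat 1 = Node (Node Leaf Leaf) Leaf) *
  (enc_nat 2 = Node Leaf (Node (Node Leaf Leaf) Leaf)) *
  (enc_nat 3 = Node (Node Leaf Leaf) (Node (Node Leaf Leaf) Leaf)).
Proof. by []. Qed.

Lemma run_depth n k (phi : cwexpr 'I_n k) :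
  run f_depth (enc_cwexpr phi) (unary (depth phi))
    (tree_size (enc_cwexpr phi) * (300 * 3 ^ k)).
Proof.
have lt_k : k < 3 ^ k by apply: ltn_expl.
move: (3 ^ k) lt_k => c lt_k.
elim: phi => [i v|a IHa b IHb|i j a IHa|i j a IHa] /=.
- run_steps ltac:(apply: run_unary) => //; have := ltn_ord i; nia.
- have da := depth_leq a; have db := depth_leq b.
  rewrite enc_tagE.
  run_steps ltac:(first [apply: IHa | apply: IHb | apply: run_umax]) => //; nia.
- have da := depth_leq a; have := ltn_ord i; have := ltn_ord j => lt_i lt_j.
  rewrite enc_tagE.
  run_steps ltac:(first [apply: IHa | apply: run_unary | apply: (@run_umax _.+1)]) => //.
  nia.
- have da := depth_leq a; have := ltn_ord i; have := ltn_ord j => lt_i lt_j.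
  rewrite enc_tagE.
  run_steps ltac:(first [apply: IHa | apply: run_unary | apply: (@run_umax _.+1)]) => //.
  nia.
Qed.

(** Each node of the expression costs a bounded number of table operations on [L]-bit entries. The
    factor [4 * x] in the hypothesis leaves room for the intermediate values of a join, and
    converting labels to unary is absorbed by [d < 3 ^ d]. *)
Lemma run_table n k (phi : cwexpr 'I_n k) y x d L :
  cw_valid phi -> depth phi <= d -> 0 < y -> 0 < x ->
  4 * x * (2 ^ n * (y * x) ^ n) < 2 ^ L ->
  run f_table
    (Node (Node (unary d) (Node (enc_nat y.+1) (enc_nat x))) (enc_cwexpr phi))
    (table d (genfun y x phi))
    (tree_size (enc_cwexpr phi) * (3 ^ d * (4000 * L.+1 ^ 3))).
Proof.
move=> Vphi le_d y_gt0 x_gt0 lt_L.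
have lt_d : d < 3 ^ d by apply: ltn_expl.
have le_dL : 3 ^ d <= 3 ^ d * L.+1 ^ 3 by rewrite leq_pmulr // expn_gt0.
have M_gt0 : 0 < 2 ^ n * (y * x) ^ n by rewrite muln_gt0 !expn_gt0 muln_gt0 y_gt0 x_gt0.
have cnt a s : cw_valid a -> @genfun 'I_n k y x a s <= 2 ^ n * (y * x) ^ n.
  by move=> Va; have := genfun_leq s Va y_gt0 x_gt0; rewrite card_ord.
have lt_cnt a s : cw_valid a -> @genfun 'I_n k y x a s < 2 ^ L.
  move=> /cnt-/(_ s) le_M; apply: leq_ltn_trans lt_L; nia.
have costE m : m * (3 ^ d * (4000 * L.+1 ^ 3)) = 4000 * (m * (3 ^ d * L.+1 ^ 3)).
  by rewrite !(mulnCA _ 4000).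
elim: phi Vphi le_d => [i v|a IHa b IHb|i j a IHa|i j a IHa] Vphi le_d.
- rewrite [enc_cwexpr _]/= /=; have lt_i : i < d by [].
  run_steps ltac:(first [apply: run_unary | apply: run_vertex]) => //.
    by apply: eq_table => s _; rewrite genfun_vertex.
  rewrite costE; move: (3 ^ d) (3 ^ d * L.+1 ^ 3) le_dL lt_d => c c' le_c lt_c.
  clear -le_c lt_c lt_i; nia.
- have /and3P [_ Va Vb] := Vphi.
  move: le_d; rewrite [depth _]/= geq_max => /andP [/(IHa Va) {}IHa /(IHb Vb) {}IHb].
  rewrite [enc_cwexpr _]/= enc_tagE /=.
  run_steps ltac:(first [apply: IHa | apply: IHb | apply: (@run_zip L OpMul)]) => //.
  + by move=> s _; rewrite /binop_dom /= !lt_cnt // -genfun_union // lt_cnt.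
  + by apply: eq_table => s _; rewrite genfun_union.
  rewrite !costE (mulnCA _ 200); move: (3 ^ d) (3 ^ d * L.+1 ^ 3) le_dL lt_d => c c' le_c lt_c.
  clear -le_c lt_c; nia.
- have /andP [ne_ij Va] := Vphi.
  move: le_d; rewrite [depth _]/= !geq_max => /and3P [lt_i lt_j /(IHa Va) {}IHa].
  rewrite [enc_cwexpr _]/= enc_tagE /=.
  run_steps ltac:(first [apply: IHa | apply: run_unary
    | apply: (@run_join L (2 ^ n * (y * x) ^ n))]) => //.
  + by move=> s; apply: cnt.
  + by move=> s; apply: genfun_join_sub0.
  + by move=> s; apply: genfun_join_sub1.
  + apply: eq_table => s ss; rewrite genfun_join //; exact: states_nth ss.
  rewrite !costE (mulnCA _ 3000); move: (3 ^ d) (3 ^ d * L.+1 ^ 3) le_dL lt_d => c c' le_c lt_c.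
  clear -le_c lt_c lt_i lt_j; nia.
- move: le_d; rewrite [depth _]/= !geq_max => /and3P [lt_i lt_j /(IHa Vphi) {}IHa].
  rewrite [enc_cwexpr _]/= enc_tagE /=.
  run_steps ltac:(first [apply: IHa | apply: run_unary
    | apply: (@run_set _ 0) | apply: (@run_set _ 1) | apply: (@run_set _ 2)
    | apply: run_pick]) => //.
  + apply: eq_table => s ss; rewrite genfun_relabel.
    by have := states_nth j ss; case: (nth 0 s j) => [|[|[|]]].
  rewrite !costE; move: (3 ^ d) (3 ^ d * L.+1 ^ 3) le_dL lt_d => c c' le_c lt_c.
  clear -le_c lt_c lt_i lt_j; nia.
Qed.

Lemma run_output m p q n :
  run f_output (Node m (Node (enc_nat (2 ^ p.+1)) (Node (enc_nat (2 ^ q.+1)) (enc_nat n))))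
    (enc_list [seq enc_nat (n %/ 2 ^ (l * q.+1) %% 2 ^ p.+1) | l <- iota 0 (spine m)./2.+1])
    ((spine m).+1 * (25 * p.+2 + 12 * q.+2 + 80)).
Proof.
have tail r : enc_nat (2 ^ r.+1) = Node Leaf (enc_nat (2 ^ r)).
  by rewrite expnS mul2n enc_natD // expn_gt0.
rewrite !tail; run_steps ltac:(apply: run_digits).
  by rewrite !spine_enc_nat_pow2.
by rewrite !spine_enc_nat_pow2; nia.
Qed.

Lemma spine_enc_list s : spine (enc_list s) = size s.
Proof. by elim: s => //= x s ->. Qed.

Lemma size_enc_list s : size s <= tree_size (enc_list s).
Proof. by elim: s => //= x s; lia. Qed.

Lemma below_nseq2 (T : finType) k (phi : cwexpr T k) S :
  below phi S (nseq (depth phi) 2).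
Proof.
apply/forallP=> l; rewrite nth_nseq; case: ltnP => [_|/state_depth -> //].
exact: state_le2.
Qed.

Theorem theorem6 :
  exists (P : program) (c d : nat),
  forall (n k : nat) (e : rel 'I_n) (phi : cwexpr 'I_n k),
    symmetric e -> irreflexive e ->
    cw_valid phi -> cw_irredundant phi -> cw_describes phi e ->
    exists2 t : nat,
      computes_in P (enc_input e phi) (enc_output e) t
      & t <= 3 ^ k * (c * tree_size (enc_input e phi) ^ d).
Proof.
have [C def_C] : {C | C = 5000 * 9 ^ 3} by eexists.
(* The numbers have [L] bits with [L + 1 <= 9 z ^ 3], table arithmetic costs a multiple of
   [(L + 1) ^ 3] per entry, and the expression has at most [z] nodes. This gives the factor [9 ^ 3]
   and the exponent 10. *)
exists prog, C, 10 => n k e phi e_sym e_irr Vphi irr desc.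
set z := tree_size (enc_input e phi).
have [c3 def_c3] : {c3 | c3 = n.+1 ^ 3} by exists (n.+1 ^ 3).
have c3_n : [/\ 2 <= 2 * c3, n.+1 <= c3, n.+1 * n.+1 <= c3 & n * (n.+1 * n.+1) <= c3].
  by rewrite def_c3 !expnS; split; nia.
(* The largest quantity needed, [4 * x * (2 ^ n * (y * x) ^ n)], is a power of 2 with exponent at
   most [6 * c3]; the factor 8 leaves room. *)
have [L def_L] : {L | L = 8 * c3} by exists (8 * c3).
pose y := 2 ^ n.+1; pose x := 2 ^ (n.+1 * n.+1).
have y_gt0 : 0 < y by rewrite expn_gt0.
have x_gt0 : 0 < x by rewrite expn_gt0.
have lt_y : y < 2 ^ L by rewrite ltn_exp2l //; lia.
have lt_x : x < 2 ^ L by rewrite ltn_exp2l //; lia.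
have def_x : x = y ^ n.+1 by rewrite -expnM.
have lt_yn : y ^ n < 2 ^ L by apply: leq_ltn_trans lt_x; rewrite def_x expnS leq_pmull.
have lt_L : 4 * x * (2 ^ n * (y * x) ^ n) < 2 ^ L.
  rewrite -[4]/(2 ^ 2) -!expnD -expnM -!expnD ltn_exp2l //.
  by rewrite mulnDl; nia.
have def_yx : y * x = 2 ^ (n.+1 + n.+1 * n.+1) by rewrite -expnD.
have lt_yx : y * x < 2 ^ L by rewrite def_yx ltn_exp2l //; lia.
(* The exponent of [y * (y * x)] is [(n + 1) * (n + 3)], written as a successor to fit
   [run_output]. *)
pose q := (n + 3) * n + n.+2.
have def_w : y * (y * x) = 2 ^ q.+1.
  by rewrite def_yx -expnD; congr (_ ^ _); rewrite /q; lia.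
have lt_w : y * (y * x) < 2 ^ L by rewrite def_w ltn_exp2l // /q; lia.
pose m := enc_list [seq enc_list [seq enc_bool (e u v) | v <- enum 'I_n] | u <- enum 'I_n].
have def_in : enc_input e phi = Node (Node (enc_nat n) m) (enc_cwexpr phi) by [].
have spine_m : spine m = n by rewrite spine_enc_list size_map size_enum_ord.
have le_nm : n <= tree_size m by rewrite -spine_m spine_enc_list; apply: size_enc_list.
have le_nz : n.+1 <= z by rewrite /z def_in /=; lia.
have le_phi : tree_size (enc_cwexpr phi) <= z by rewrite /z def_in /=; lia.
have le_d := depth_leq phi.
have lt_d : depth phi < 3 ^ depth phi by apply: ltn_expl.
have le_3d : 3 ^ depth phi <= 3 ^ k by rewrite leq_exp2l.
have [Q def_Q] : {Q | Q = L.+1 ^ 3} by exists (L.+1 ^ 3).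
have Q_L : L.+1 <= Q by rewrite def_Q !expnS; nia.
(* The common unit in which all parts of the running time are measured. *)
have [U def_U] : {U | U = 3 ^ k * (z * Q)} by exists (3 ^ k * (z * Q)).
have k_gt0 : 0 < 3 ^ k by rewrite expn_gt0.
have z_gt0 : 0 < z by lia.
have Q_gt0 : 0 < Q by lia.
have zQ_U : z * Q <= U by rewrite def_U leq_pmull.
have Q_U : Q <= U by apply: leq_trans zQ_U; rewrite leq_pmull.
have k_U : 3 ^ k <= U by rewrite def_U leq_pmulr // muln_gt0 z_gt0.
have r_pow2 : run f_pow2 m (enc_nat (2 ^ n)) (10 * U).
  by apply: run_conv (run_pow2 m) _ _; rewrite spine_m //; lia.
have r_dbl : run f_dbl (enc_nat (2 ^ n)) (enc_nat y) 6.
  by rewrite /y expnS mul2n; apply: run_dbl.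
have r_pow : run f_pow (Node m (enc_nat y)) (enc_nat (y ^ n)) (100 * U).
  apply: run_conv (run_pow (L := L) y_gt0 _) _ _; rewrite spine_m -?def_x //.
  by rewrite -def_Q -mulnA leq_mul2l /=; apply: leq_trans zQ_U; rewrite leq_mul2r le_nz orbT.
have mulQ : 80 * L.+1 * L.+1 ^ 2 <= 80 * U by rewrite -mulnA -expnS -def_Q leq_mul2l.
have r_mul : run f_mul (Node (enc_nat y) (enc_nat (y ^ n))) (enc_nat x) (80 * U).
  by apply: run_conv (run_mul lt_y lt_yn _) _ mulQ; rewrite -expnS -def_x.
have r_mul' : run f_mul (Node (enc_nat y) (enc_nat x)) (enc_nat (y * x)) (80 * U).
  exact: run_conv (run_mul lt_y lt_x lt_yx) _ mulQ.
have r_mul'' : run f_mul (Node (enc_nat y) (enc_nat (y * x))) (enc_nat (2 ^ q.+1)) (80 * U).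
  by apply: run_conv (run_mul lt_y lt_yx lt_w) _ mulQ; rewrite def_w.
have r_inc : run f_inc (enc_nat y) (enc_nat y.+1) (10 * U).
  by apply: run_conv (run_inc lt_y) _ _ => //; lia.
have r_depth : run f_depth (enc_cwexpr phi) (unary (depth phi)) (300 * U).
  apply: run_conv (run_depth phi) _ _ => //; rewrite mulnCA leq_mul2l /= def_U mulnC leq_mul2l.
  by apply/orP; right; apply: leq_trans le_phi _; rewrite leq_pmulr.
have r_table := run_table Vphi (leqnn _) y_gt0 x_gt0 lt_L.
have {}r_table : run f_table
    (Node (Node (unary (depth phi)) (Node (enc_nat y.+1) (enc_nat x))) (enc_cwexpr phi))
    (table (depth phi) (genfun y x phi)) (4000 * U).
  apply: run_conv r_table _ _ => //; rewrite -def_Q !(mulnCA _ 4000) leq_mul2l /= def_U.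
  by rewrite mulnCA; apply: leq_mul => //; apply: leq_mul.
have r_last := run_last (depth phi) (genfun y x phi).
have {}r_last : run f_last (Node (unary (depth phi)) (table (depth phi) (genfun y x phi)))
    (enc_nat (genfun y x phi (nseq (depth phi) 2))) (20 * U).
  by apply: run_conv r_last _ _ => //; lia.
have r_output := run_output m n q (genfun y x phi (nseq (depth phi) 2)).
have {}r_output : run f_output (Node m (Node (enc_nat y) (Node (enc_nat (2 ^ q.+1))
    (enc_nat (genfun y x phi (nseq (depth phi) 2)))))) (enc_output e) (100 * U).
  apply: run_conv r_output _ _; rewrite spine_m.
    congr enc_list; apply/eq_in_map => l; rewrite mem_iota add0n ltnS => /andP [_ le_l].
    have := @genfun_digit _ _ e phi (nseq (depth phi) 2) l e_sym e_irr Vphi irr desc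
      (below_nseq2 phi).
    cbv zeta; rewrite card_ord -/y -def_x => /(_ le_l) <-; rewrite -expnM.
    by congr (enc_nat (_ %/ 2 ^ _ %% _)); rewrite /q; lia.
  apply: (@leq_trans (100 * (z * Q))); last by rewrite leq_mul2l.
  rewrite mulnCA; apply: leq_mul => //; rewrite /q; lia.
have le_L : L.+1 <= 9 * z ^ 3.
  have : c3 <= z ^ 3 by rewrite def_c3 leq_exp2r.
  lia.
have le_Q : Q <= 9 ^ 3 * z ^ 9.
  by rewrite def_Q (expnM z 3 3 : z ^ 9 = _) -expnMn leq_exp2r.
suff : run f_main (enc_input e phi) (enc_output e) (5000 * U).
  move=> /run_conv; apply=> //; rewrite def_U mulnCA leq_mul2l; apply/orP; right.
  by rewrite def_C (expnS z 9) -(mulnA 5000) leq_mul2l (mulnCA _ z) leq_mul2l le_Q !orbT.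
rewrite def_in; run_steps ltac:(first [exact: r_pow2 | exact: r_dbl | exact: r_pow
  | exact: r_mul | exact: r_mul' | exact: r_mul'' | exact: r_inc | exact: r_depth
  | exact: r_table | exact: r_last | exact: r_output]) => //.
clear -k_U k_gt0; lia.
Qed.
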